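(* Suppose that $p>2$ is an even integer. There exists a constant $\rho>0$, depending only on $p$, such that the following holds: if $f\in H^p$ satisfies $f(0)\neq 0$ and $q_{1,p}[f](z) = a(z-w)$ for some $a,w\in\mathbb{C}$, then $|w|\geq\rho$.
   Context: $H^p$ denotes the classical Hardy space of holomorphic functions on the open unit disk $\mathbb{D}$, with norm $\|f\|_p = \left(\sup_{0\le r<1}\frac{1}{2\pi}\int_0^{2\pi}|f(re^{i\theta})|^p\,d\theta\right)^{1/p}$. For an integer $n\ge 0$ let $\mathcal{P}_n$ be the set of complex polynomials of degree at most $n$. For $1<p<\infty$ and $f\in H^p$, not identically zero, the $n$-th optimal polynomial approximant (OPA) to $1/f$ in $H^p$, denoted $q_{n,p}[f]$, is the unique polynomial $q\in\mathcal{P}_n$ minimizing $\|1-qf\|_p$ over $\mathcal{P}_n$. *)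

(* Defs.v *)
From Stdlib Require Import Reals.
From Coquelicot Require Import Coquelicot.
Open Scope R_scope.

(** Functions on the unit disk are total functions [C -> C]; nothing below looks
    at the values of [f] outside the disk. *)
Definition holomorphic_on_disk (f : C -> C) : Prop :=
  forall z : C, Cmod z < 1 -> ex_derive (K := C_AbsRing) (V := C_NormedModule) f z.

(** [x ^ s] for [0 <= x] and [0 < s].  [Rpower] alone is wrong at the origin:
    [Rpower 0 s = 1]. *)
Definition rpow (x s : R) : R :=
  if Req_EM_T x 0 then 0 else Rpower x s.

Definition circle_mean (p : R) (f : C -> C) (r : R) : R :=
  / (2 * PI) *
  RInt (fun t : R => rpow (Cmod (f (r * cos t, r * sin t))) p) 0 (2 * PI).

(** Takes the value [p_infty] when the means are unbounded.  The [m_infty] branch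
    is never reached, since the set of means is nonempty. *)
Definition Hp_norm (p : R) (f : C -> C) : Rbar :=
  match Lub_Rbar (fun x : R => exists r : R, 0 <= r < 1 /\ x = circle_mean p f r) with
  | Finite s => Finite (rpow s (/ p))
  | p_infty => p_infty
  | m_infty => m_infty
  end.

Definition in_Hp (p : R) (f : C -> C) : Prop :=
  holomorphic_on_disk f /\ Rbar_lt (Hp_norm p f) p_infty.

(** Polynomials are identified with polynomial functions on [C]. *)
Definition poly_le (n : nat) (q : C -> C) : Prop :=
  exists c : nat -> C, forall z : C,
    q z = sum_n (fun k : nat => Cmult (c k) (Cpow z k)) n.

(** [q] minimizes [|| 1 - q f ||_p] over the polynomials of degree at most [n].
    For [1 < p] and [f] in [H^p] not identically zero the minimizer exists and is
    unique, so that [is_OPA n p f q] says that [q] is the [n]-th optimal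
    polynomial approximant to [1 / f] in [H^p]. *)
Definition is_OPA (n : nat) (p : R) (f q : C -> C) : Prop :=
  poly_le n q /\
  forall q' : C -> C, poly_le n q' ->
    Rbar_le (Hp_norm p (fun z : C => Cminus 1 (Cmult (q z) (f z))))
            (Hp_norm p (fun z : C => Cminus 1 (Cmult (q' z) (f z)))).

(* Main.v *)
Require Import Defs.
From Stdlib Require Import Reals Lra Lia Psatz IndefiniteDescription.
From Coquelicot Require Import Coquelicot.
Open Scope R_scope.

(** Let [p] be even, [q = a (z - w)], [h = q f], and let [u = 1 - h] be the residual.
    Minimality is used twice.

    Comparison with the zero polynomial gives [||u||_p <= 1].  The function
    [|1 - h|^p] exceeds its tangent plane [1 - p Re h] at [h = 0] by at least a
    multiple of [|h|^2 + |h|^p] ([power_convexity_defect]).  Since the mean of [Re h]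
    over a circle is [Re h(0) = Re (- a w f(0))], the means of [|h|^2 + |h|^p] are at
    most a multiple of [|a| |w| |f(0)|].

    Comparison with [q + t e], for a small [t] and a unimodular [e], gives the
    first-order condition that the mean of [|u|^(p-2) conj u f] vanishes.  Here
    [|u|^(p-2) conj u] differs from 1 by at most a multiple of [|h| + |h|^(p-1)]
    ([duality_map_near_one]).  If [|w| <= 1/4], then [|f| <= 4 |h| / |a|] on circles of
    radius at least [1/2], and the mean of [f] is [f(0)]; so [|f(0)|] is at most a
    multiple of the means of [|h|^2 + |h|^p], divided by [|a|].

    Together, [|f(0)| <= const(p) |w| |f(0)|], which bounds [|w|] from below.  The case
    [a = 0] is the same computation with [h = 0]; it ends in [f(0) = 0].

    As the norm is a supremum over circles inside the disk, the first-order
    condition is used in integrated form: if [q + t e] lowered the means on all circles of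
    radius at least [1/2] by a fixed amount, it would lower the norm
    ([minimal_norm_no_uniform_gain]).  That small circles can be ignored is the
    monotonicity of the means of [|g|^p], which for even [p] reduces to that of the
    means of [|g|^2] for holomorphic [g] ([mean_square_monotone]).  It and the mean
    value property ([mean_value]) come from Goursat's theorem on rectangles in the
    logarithmic coordinate, where circles become vertical segments. *)

(** * Integration over real intervals *)

(** Rewriting with the generic integration rules fails when an integrand is
    written with the operations of [R]; these are the same rules in that form. *)
Lemma RInt_ext_R (f g : R -> R) a b : (forall x, f x = g x) -> RInt f a b = RInt g a b.
Proof. intros H. apply RInt_ext. intros; apply H. Qed.

Lemma RInt_plus_R (f g : R -> R) a b : ex_RInt f a b -> ex_RInt g a b ->
  RInt (fun x => f x + g x) a b = RInt f a b + RInt g a b.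
Proof. exact (RInt_plus (V := R_CompleteNormedModule) f g a b). Qed.

Lemma RInt_minus_R (f g : R -> R) a b : ex_RInt f a b -> ex_RInt g a b ->
  RInt (fun x => f x - g x) a b = RInt f a b - RInt g a b.
Proof. exact (RInt_minus (V := R_CompleteNormedModule) f g a b). Qed.

Lemma RInt_scal_R (f : R -> R) k a b : ex_RInt f a b ->
  RInt (fun x => k * f x) a b = k * RInt f a b.
Proof. exact (RInt_scal (V := R_CompleteNormedModule) f a b k). Qed.

Lemma RInt_const_R (k a b : R) : RInt (fun _ => k) a b = (b - a) * k.
Proof. exact (RInt_const (V := R_CompleteNormedModule) a b k). Qed.

Lemma ex_RInt_plus_R (f g : R -> R) a b : ex_RInt f a b -> ex_RInt g a b ->
  ex_RInt (fun x => f x + g x) a b.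
Proof. exact (ex_RInt_plus (V := R_NormedModule) f g a b). Qed.

Lemma ex_RInt_minus_R (f g : R -> R) a b : ex_RInt f a b -> ex_RInt g a b ->
  ex_RInt (fun x => f x - g x) a b.
Proof. exact (ex_RInt_minus (V := R_NormedModule) f g a b). Qed.

Lemma ex_RInt_const_R (k a b : R) : ex_RInt (fun _ => k) a b.
Proof. exact (ex_RInt_const (V := R_NormedModule) a b k). Qed.

(** * Goursat's theorem for closed real 1-forms *)

(** Bisection: a property that always passes to some rectangle of half the size
    passes down to arbitrarily small rectangles around one point.  The rectangles
    are kept similar to the first one, so [A] and [B] are its two sides. *)
Lemma nested_rectangles (A B : R) (Bad : R -> R -> nat -> Prop) (x0 y0 : R) :
  0 <= A -> 0 <= B ->
  (forall x y n, Bad x y n -> exists x' y',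
     x <= x' /\ x' + A / 2 ^ S n <= x + A / 2 ^ n /\
     y <= y' /\ y' + B / 2 ^ S n <= y + B / 2 ^ n /\ Bad x' y' (S n)) ->
  Bad x0 y0 0%nat ->
  exists x y, forall n, exists xn yn,
    Bad xn yn n /\ x0 <= xn /\ xn <= x <= xn + A / 2 ^ n /\ xn + A / 2 ^ n <= x0 + A /\
    y0 <= yn /\ yn <= y <= yn + B / 2 ^ n /\ yn + B / 2 ^ n <= y0 + B.
Proof.
  intros HA HB Hstep H0.
  destruct (functional_choice (fun (s s' : R * R * nat) =>
    Bad (fst (fst s)) (snd (fst s)) (snd s) ->
    snd s' = S (snd s) /\
    fst (fst s) <= fst (fst s') /\
    fst (fst s') + A / 2 ^ S (snd s) <= fst (fst s) + A / 2 ^ (snd s) /\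
    snd (fst s) <= snd (fst s') /\
    snd (fst s') + B / 2 ^ S (snd s) <= snd (fst s) + B / 2 ^ (snd s) /\
    Bad (fst (fst s')) (snd (fst s')) (S (snd s)))) as [next Hnext].
  { intros [[x y] n]; simpl fst; simpl snd.
    destruct (Classical_Prop.classic (Bad x y n)) as [Hb|Hb].
    - destruct (Hstep x y n Hb) as (x' & y' & H).
      exists (x', y', S n); simpl fst; simpl snd; intuition.
    - exists (x, y, n); intuition. }
  set (u := fix u (n : nat) : R * R * nat :=
              match n with O => (x0, y0, 0%nat) | S m => next (u m) end).
  set (X := fun n => fst (fst (u n))). set (Y := fun n => snd (fst (u n))).
  assert (Hu : forall n, snd (u n) = n /\ Bad (X n) (Y n) n).
  { induction n as [|n [IH1 IH2]]; [split; [reflexivity|exact H0]|].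
    unfold X, Y in *. pose proof (Hnext (u n)) as H. rewrite IH1 in H.
    specialize (H IH2). simpl u. intuition. }
  assert (HX : forall n, X n <= X (S n) /\ X (S n) + A / 2 ^ S n <= X n + A / 2 ^ n /\
                         Y n <= Y (S n) /\ Y (S n) + B / 2 ^ S n <= Y n + B / 2 ^ n).
  { intros n. destruct (Hu n) as [H1 H2]. pose proof (Hnext (u n)) as H.
    rewrite H1 in H. specialize (H H2). unfold X, Y. simpl u. intuition. }
  assert (mono : forall (Z : nat -> R) (L : R), 0 <= L ->
    (forall n, Z n <= Z (S n) /\ Z (S n) + L / 2 ^ S n <= Z n + L / 2 ^ n) ->
    exists z, forall n, Z 0%nat <= Z n /\ Z n <= z <= Z n + L / 2 ^ n /\
                        Z n + L / 2 ^ n <= Z 0%nat + L).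
  { intros Z L HL HZ.
    assert (Hp : forall n, 0 <= L / 2 ^ n).
    { intros n. apply Rdiv_le_0_compat; [exact HL|apply pow_lt; lra]. }
    assert (up : forall m n, Z n <= Z (n + m)%nat /\
                             Z (n + m)%nat + L / 2 ^ (n + m) <= Z n + L / 2 ^ n).
    { induction m as [|m IH]; intros n.
      - rewrite Nat.add_0_r; lra.
      - rewrite Nat.add_succ_r. specialize (IH n). specialize (HZ (n + m)%nat). lra. }
    destruct (completeness (fun z => exists n, z = Z n)) as [z [Hz1 Hz2]].
    - exists (Z 0%nat + L). intros z [n ->]. pose proof (up n 0%nat) as H. pose proof (Hp n).
      simpl in H. lra.
    - exists (Z 0%nat); now exists 0%nat.
    - exists z. intros n.
      pose proof (up n 0%nat) as H. simpl in H.
      split; [lra|split; [split|lra]].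
      + apply Hz1; now exists n.
      + apply Hz2. intros z' [m ->].
        destruct (Nat.le_gt_cases m n) as [Hmn|Hmn].
        * replace n with (m + (n - m))%nat by lia.
          pose proof (up (n - m)%nat m) as H'. pose proof (Hp (m + (n - m))%nat). lra.
        * replace m with (n + (m - n))%nat by lia.
          pose proof (up (m - n)%nat n) as H'. pose proof (Hp (n + (m - n))%nat). lra. }
  destruct (mono X A HA) as [x Hx]. { intros n; specialize (HX n); tauto. }
  destruct (mono Y B HB) as [y Hy]. { intros n; specialize (HX n); tauto. }
  exists x, y. intros n. exists (X n), (Y n).
  destruct (Hu n). specialize (Hx n). specialize (Hy n). 
  change (X 0%nat) with x0 in Hx. change (Y 0%nat) with y0 in Hy. tauto.
Qed.

(** The integral of [P dx + Q dy] along the boundary of [a,b] x [c,d], with the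
    opposite sides paired so that no orientation has to be tracked. *)
Definition circulation (P Q : R -> R -> R) (a b c d : R) : R :=
  RInt (fun x => P x c - P x d) a b + RInt (fun y => Q b y - Q a y) c d.

Section Rectangle.
Variables (P Q : R -> R -> R) (D : R -> Prop).
Hypothesis D_convex : forall x x' t, D x -> D x' -> x <= t <= x' -> D t.
Hypothesis form_closed : forall x y, D x -> exists px pq qy,
  differentiable_pt_lim P x y px pq /\ differentiable_pt_lim Q x y pq qy.

Lemma closed_form_continuous_dx x y : D x -> continuous (fun x => P x y) x.
Proof.
  intros Hx. destruct (form_closed x y Hx) as (px & pq & qy & HP & HQ).
  assert (H : continuity_2d_pt P x y) by (apply differentiable_continuity_pt; exists px, pq; exact HP).
  apply continuity_pt_filterlim. 
  intros eps Heps. destruct (H (mkposreal eps Heps)) as [d Hd].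
  exists d; split; [apply cond_pos|]. intros u [_ Hu]. unfold dist in *; simpl in *; unfold Rdist in *.
  apply Hd; [exact Hu|]. rewrite Rminus_diag, Rabs_R0. apply cond_pos.
Qed.

Lemma closed_form_continuous_dy x y : D x -> continuous (fun y => Q x y) y.
Proof.
  intros Hx. destruct (form_closed x y Hx) as (px & pq & qy & HP & HQ).
  assert (H : continuity_2d_pt Q x y) by (apply differentiable_continuity_pt; exists pq, qy; exact HQ).
  apply continuity_pt_filterlim. 
  intros eps Heps. destruct (H (mkposreal eps Heps)) as [d Hd].
  exists d; split; [apply cond_pos|]. intros u [_ Hu]. unfold dist in *; simpl in *; unfold Rdist in *.
  apply Hd; [|exact Hu]. rewrite Rminus_diag, Rabs_R0. apply cond_pos.
Qed.

Lemma ex_RInt_dx a b c : a <= b -> D a -> D b -> ex_RInt (fun x => P x c) a b.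
Proof.
  intros Hab Ha Hb. apply (ex_RInt_continuous (V := R_CompleteNormedModule)).
  rewrite Rmin_left, Rmax_right by lra. intros x Hx. apply closed_form_continuous_dx. now apply (D_convex a b).
Qed.

Lemma ex_RInt_dy a c d : D a -> ex_RInt (fun y => Q a y) c d.
Proof.
  intros Ha. apply (ex_RInt_continuous (V := R_CompleteNormedModule)).
  intros y _. now apply closed_form_continuous_dy.
Qed.

Lemma circulation_split_x a m b c d : a <= m <= b -> D a -> D b ->
  circulation P Q a b c d = circulation P Q a m c d + circulation P Q m b c d.
Proof.
  intros Hm Ha Hb. assert (Dm : D m) by now apply (D_convex a b).
  unfold circulation.
  rewrite <- (RInt_Chasles (fun x => P x c - P x d) a m b);
    try (apply ex_RInt_minus_R; apply ex_RInt_dx; tauto || lra).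
  rewrite (RInt_ext_R (fun y => Q b y - Q a y) (fun y => (Q b y - Q m y) + (Q m y - Q a y))).
  2:{ intros; ring. }
  rewrite (RInt_plus_R (fun y => Q b y - Q m y)
             (fun y => Q m y - Q a y)); try (apply ex_RInt_minus_R; now apply ex_RInt_dy).
  unfold plus; simpl. ring.
Qed.

Lemma circulation_split_y a b c m d : a <= b -> D a -> D b ->
  circulation P Q a b c d = circulation P Q a b c m + circulation P Q a b m d.
Proof.
  intros Hab Ha Hb. unfold circulation.
  rewrite <- (RInt_Chasles (fun y => Q b y - Q a y) c m d);
    try (apply ex_RInt_minus_R; now apply ex_RInt_dy).
  rewrite (RInt_ext_R (fun x => P x c - P x d) (fun x => (P x c - P x m) + (P x m - P x d))).
  2:{ intros; ring. }
  rewrite (RInt_plus_R (fun x => P x c - P x m)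
             (fun x => P x m - P x d)); try (apply ex_RInt_minus_R; now apply ex_RInt_dx).
  unfold plus; simpl. ring.
Qed.

(** The circulation of the affine part of the form vanishes because the form is
    closed, so only the remainder of differentiability counts: it is small
    compared with the diameter, and it is integrated over the perimeter. *)
Lemma circulation_local x y (e : R) : D x -> 0 < e -> exists d, 0 < d /\
  forall a b c d' : R, D a -> D b -> a <= x <= b -> c <= y <= d' -> b - a < d -> d' - c < d ->
  Rabs (circulation P Q a b c d') <= e * ((b - a) + (d' - c)) * ((b - a) + (d' - c)).
Proof.
  intros Hx He. destruct (form_closed x y Hx) as (px & pq & qy & HP & HQ).
  assert (He2 : 0 < e / 2) by lra.
  destruct (HP (mkposreal _ He2)) as [d1 H1]. destruct (HQ (mkposreal _ He2)) as [d2 H2].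
  exists (Rmin d1 d2). split. { apply Rmin_pos; apply cond_pos. }
  intros a b c d Da Db Hab Hcd Hbd Hdd.
  pose proof (Rmin_l d1 d2). pose proof (Rmin_r d1 d2).
  set (L := (b - a) + (d - c)).
  assert (B : forall u v, a <= u <= b -> c <= v <= d ->
     Rabs (P u v - P x y - (px * (u - x) + pq * (v - y))) <= e / 2 * L /\
     Rabs (Q u v - Q x y - (pq * (u - x) + qy * (v - y))) <= e / 2 * L).
  { intros u v Hu Hv.
    assert (Rabs (u - x) <= b - a) by (apply Rabs_le; lra).
    assert (Rabs (v - y) <= d - c) by (apply Rabs_le; lra).
    assert (Rmax (Rabs (u - x)) (Rabs (v - y)) <= L) by (apply Rmax_lub; unfold L; lra).
    split.
    - eapply Rle_trans; [apply H1; lra|]. simpl. apply Rmult_le_compat_l; lra.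
    - eapply Rle_trans; [apply H2; lra|]. simpl. apply Rmult_le_compat_l; lra. }
  assert (EP : Rabs (RInt (fun x => P x c - P x d + pq * (d - c)) a b) <= (b - a) * (e * L)).
  { apply abs_RInt_le_const; [lra| |].
    - apply ex_RInt_plus_R; [|apply ex_RInt_const_R].
      apply ex_RInt_minus_R; apply ex_RInt_dx; tauto || lra.
    - intros t Ht. destruct (B t c Ht) as [b1 _]; [lra|]. destruct (B t d Ht) as [b2 _]; [lra|].
      apply Rabs_le_between in b1. apply Rabs_le_between in b2. apply Rabs_le_between.
      lra. }
  assert (EQ : Rabs (RInt (fun y => Q b y - Q a y - pq * (b - a)) c d) <= (d - c) * (e * L)).
  { apply abs_RInt_le_const; [lra| |].
    - apply ex_RInt_minus_R; [|apply ex_RInt_const_R].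
      apply ex_RInt_minus_R; apply ex_RInt_dy; tauto || lra.
    - intros t Ht. destruct (B a t) as [_ b1]; [lra|lra|]. destruct (B b t) as [_ b2]; [lra|lra|].
      apply Rabs_le_between in b1. apply Rabs_le_between in b2. apply Rabs_le_between.
      lra. }
  replace (circulation P Q a b c d) with
    (RInt (fun x => P x c - P x d + pq * (d - c)) a b + RInt (fun y => Q b y - Q a y - pq * (b - a)) c d).
  - eapply Rle_trans; [apply Rabs_triang|].
    replace (e * L * L) with ((b - a) * (e * L) + (d - c) * (e * L)) by (unfold L; ring). lra.
  - unfold circulation.
    rewrite (RInt_plus_R (fun x => P x c - P x d) (fun _ => pq * (d - c))).
    2:{ apply ex_RInt_minus_R; apply ex_RInt_dx; tauto || lra. }
    2:{ apply ex_RInt_const_R. }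
    rewrite (RInt_minus_R (fun y => Q b y - Q a y) (fun _ => pq * (b - a))).
    2:{ apply ex_RInt_minus_R; apply ex_RInt_dy; tauto || lra. }
    2:{ apply ex_RInt_const_R. }
    rewrite !RInt_const_R.
    ring.
Qed.

(** Goursat's argument: the partial derivatives of a function that is complex
    differentiable at every point are not yet known to be continuous, so Green's
    formula would be out of place.  One of the four quarters of a rectangle carries
    at least a quarter of the circulation, so a nonzero circulation would stay
    comparable to the area down to a point, against [circulation_local]. *)
Lemma circulation_zero a b c d : a <= b -> c <= d -> D a -> D b -> circulation P Q a b c d = 0.
Proof.
  intros Hab Hcd Da Db.
  set (A := b - a). set (B := d - c).
  destruct (Req_dec (circulation P Q a b c d) 0) as [|Hne]; [assumption|exfalso].
  set (e := Rabs (circulation P Q a b c d) / 2).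
  assert (He : 0 < e). { unfold e. apply Rabs_pos_lt in Hne. lra. }
  assert (Hpow : forall n, 0 < 2 ^ n) by (intros; apply pow_lt; lra).
  assert (HA0 : forall n, 0 <= A / 2 ^ n).
  { intros n. apply Rdiv_le_0_compat; [unfold A; lra|auto]. }
  assert (HB0 : forall n, 0 <= B / 2 ^ n).
  { intros n. apply Rdiv_le_0_compat; [unfold B; lra|auto]. }
  destruct (nested_rectangles A B (fun x y n =>
     a <= x /\ x + A / 2 ^ n <= b /\
     e / 4 ^ n < Rabs (circulation P Q x (x + A / 2 ^ n) y (y + B / 2 ^ n))) a c)
    as (x & y & Hxy).
  - unfold A; lra.
  - unfold B; lra.
  - intros x y n (Hx1 & Hx2 & Hbad).
    set (A' := A / 2 ^ S n) in *. set (B' := B / 2 ^ S n) in *.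
    assert (EA : A / 2 ^ n = A' + A') by (unfold A'; simpl; field; specialize (Hpow n); lra).
    assert (EB : B / 2 ^ n = B' + B') by (unfold B'; simpl; field; specialize (Hpow n); lra).
    rewrite EA in *. rewrite EB in *.
    assert (0 <= A') by apply HA0. assert (0 <= B') by apply HB0.
    assert (E4 : e / 4 ^ n = 4 * (e / 4 ^ S n)) by (simpl; field; apply pow_nonzero; lra).
    rewrite E4 in Hbad.
    assert (Dx : D x) by (apply (D_convex a b); lra || tauto).
    assert (Dx' : D (x + A')) by (apply (D_convex a b); lra || tauto).
    assert (Dx'' : D (x + (A' + A'))) by (apply (D_convex a b); lra || tauto).
    rewrite (circulation_split_x x (x + A')) in Hbad by (lra || tauto).
    rewrite (circulation_split_y x (x + A') y (y + B')) in Hbad by (lra || tauto).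
    rewrite (circulation_split_y (x + A') _ y (y + B')) in Hbad by (lra || tauto).
    rewrite <- !Rplus_assoc in Hbad.
    destruct (Rlt_dec (e / 4 ^ S n) (Rabs (circulation P Q x (x + A') y (y + B')))) as [h1|h1].
    { exists x, y. repeat split; lra || assumption. }
    destruct (Rlt_dec (e / 4 ^ S n) (Rabs (circulation P Q x (x + A') (y + B') (y + B' + B')))) as [h2|h2].
    { exists x, (y + B'). repeat split; lra || assumption. }
    destruct (Rlt_dec (e / 4 ^ S n) (Rabs (circulation P Q (x + A') (x + A' + A') y (y + B')))) as [h3|h3].
    { exists (x + A'), y. repeat split; lra || assumption. }
    destruct (Rlt_dec (e / 4 ^ S n) (Rabs (circulation P Q (x + A') (x + A' + A') (y + B') (y + B' + B')))) as [h4|h4].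
    { exists (x + A'), (y + B'). repeat split; lra || assumption. }
    exfalso.
    revert Hbad h1 h2 h3 h4.
    set (c1 := circulation P Q x (x + A') y (y + B')).
    set (c2 := circulation P Q x (x + A') (y + B') (y + B' + B')).
    set (c3 := circulation P Q (x + A') (x + A' + A') y (y + B')).
    set (c4 := circulation P Q (x + A') (x + A' + A') (y + B') (y + B' + B')).
    intros Hbad h1 h2 h3 h4.
    pose proof (Rabs_triang (c1 + c2 + c3) c4). pose proof (Rabs_triang (c1 + c2) c3).
    pose proof (Rabs_triang c1 c2). lra.
  - simpl. rewrite !Rdiv_1_r. replace (a + A) with b by (unfold A; ring).
    replace (c + B) with d by (unfold B; ring). repeat split; try lra. unfold e in *; lra.
  - assert (Dx : D x).
    { destruct (Hxy 0%nat) as (xn & yn & _ & H). simpl in H. rewrite Rdiv_1_r in H.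
      apply (D_convex a b); try assumption. unfold A in H; lra. }
    set (L := A + B).
    assert (HL : 0 <= L) by (unfold L, A, B; lra).
    (* chosen so that e' L^2 <= e, which contradicts the lower bound e / 4^N *)
    set (e' := e / (L * L + 1)).
    assert (He' : 0 < e'). { apply Rdiv_lt_0_compat; [assumption|nra]. }
    destruct (circulation_local x y e' Dx He') as (dl & Hdl & Hloc).
    destruct (pow_lt_1_zero (/ 2)) with (y := dl / (L + 1)) as [N HN].
    { rewrite Rabs_right; lra. }
    { apply Rdiv_lt_0_compat; lra. }
    specialize (HN N (le_n N)). rewrite pow_inv in HN.
    assert (Hi : 0 < / 2 ^ N) by (apply Rinv_0_lt_compat; auto).
    rewrite Rabs_right in HN by lra.
    assert (HN' : L * / 2 ^ N < dl).
    { apply (Rmult_lt_compat_r (L + 1)) in HN; [|lra].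
      unfold Rdiv in HN. rewrite Rmult_assoc, Rinv_l, Rmult_1_r in HN by lra. nra. }
    destruct (Hxy N) as (xn & yn & (H1 & H2 & Hbad) & Hx0 & Hx & Hx1 & Hy0 & Hy & Hy1).
    specialize (HA0 N). specialize (HB0 N).
    assert (EL : A / 2 ^ N + B / 2 ^ N = L * / 2 ^ N) by (unfold L, Rdiv; ring).
    assert (Hl := Hloc xn (xn + A / 2 ^ N) yn (yn + B / 2 ^ N)).
    assert (D xn) by (apply (D_convex a b); lra || tauto).
    assert (D (xn + A / 2 ^ N)) by (apply (D_convex a b); lra || tauto).
    specialize (Hl ltac:(assumption) ltac:(assumption) Hx Hy ltac:(lra) ltac:(lra)).
    replace (xn + A / 2 ^ N - xn + (yn + B / 2 ^ N - yn)) with (L * / 2 ^ N) in Hl by lra.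
    assert (E4 : / 4 ^ N = / 2 ^ N * / 2 ^ N).
    { rewrite <- Rinv_mult. f_equal. rewrite <- Rpow_mult_distr. f_equal. }
    unfold Rdiv at 1 in Hbad. rewrite E4 in Hbad.
    assert (e' * (L * L) <= e).
    { unfold e'. unfold Rdiv. rewrite Rmult_assoc. rewrite <- (Rmult_1_r e) at 2.
      apply Rmult_le_compat_l; [lra|]. apply Rmult_le_reg_l with (L * L + 1); [nra|].
      rewrite <- Rmult_assoc, Rinv_r by nra. nra. }
    assert (0 < / 2 ^ N * / 2 ^ N) by nra.
    nra.
Qed.

End Rectangle.

(** On a rectangle of height one period the horizontal sides cancel. *)
Lemma closed_periodic_form_RInt (P Q : R -> R -> R) (D : R -> Prop) (T : R) :
  (forall x x' t, D x -> D x' -> x <= t <= x' -> D t) ->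
  (forall x y, D x -> exists px pq qy,
     differentiable_pt_lim P x y px pq /\ differentiable_pt_lim Q x y pq qy) ->
  0 <= T -> (forall x, P x T = P x 0) ->
  forall a b, D a -> D b -> RInt (Q a) 0 T = RInt (Q b) 0 T.
Proof.
  intros HD Hcl HT Hper.
  assert (main : forall a b, a <= b -> D a -> D b -> RInt (Q a) 0 T = RInt (Q b) 0 T).
  { intros a b Hab Ha Hb.
    pose proof (circulation_zero P Q D HD Hcl a b 0 T Hab HT Ha Hb) as H.
    unfold circulation in H.
    rewrite (RInt_ext_R _ (fun _ => 0)) in H by (intros; rewrite Hper; lra).
    rewrite RInt_const_R, RInt_minus_R in H
      by (eapply ex_RInt_dy; eassumption).
    change (fun y => Q a y) with (Q a) in H. change (fun y => Q b y) with (Q b) in H. lra. }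
  intros a b Ha Hb. destruct (Rle_dec a b).
  - now apply main.
  - symmetry; apply main; lra || assumption.
Qed.

(** * The Cauchy-Riemann equations *)

Lemma differentiable_fst x y : differentiable_pt_lim (fun u _ => u) x y 1 0.
Proof.
  intros eps. exists eps. intros u v _ _.
  replace (u - x - (1 * (u - x) + 0 * (v - y))) with 0 by ring. rewrite Rabs_R0.
  apply Rmult_le_pos; [apply Rlt_le, cond_pos|].
  eapply Rle_trans; [apply Rabs_pos|apply Rmax_l].
Qed.

Lemma differentiable_snd x y : differentiable_pt_lim (fun _ v => v) x y 0 1.
Proof.
  intros eps. exists eps. intros u v _ _.
  replace (v - y - (0 * (u - x) + 1 * (v - y))) with 0 by ring. rewrite Rabs_R0.
  apply Rmult_le_pos; [apply Rlt_le, cond_pos|].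
  eapply Rle_trans; [apply Rabs_pos|apply Rmax_l].
Qed.

Lemma differentiable_const k x y : differentiable_pt_lim (fun _ _ => k) x y 0 0.
Proof.
  intros eps. exists eps. intros u v _ _.
  replace (k - k - (0 * (u - x) + 0 * (v - y))) with 0 by ring. rewrite Rabs_R0.
  apply Rmult_le_pos; [apply Rlt_le, cond_pos|].
  eapply Rle_trans; [apply Rabs_pos|apply Rmax_l].
Qed.

Lemma differentiable_lim_eq f x y l m l' m' :
  differentiable_pt_lim f x y l m -> l = l' -> m = m' -> differentiable_pt_lim f x y l' m'.
Proof. now intros H -> ->. Qed.

Lemma differentiable_plus f g x y f1 f2 g1 g2 :
  differentiable_pt_lim f x y f1 f2 -> differentiable_pt_lim g x y g1 g2 ->
  differentiable_pt_lim (fun u v => f u v + g u v) x y (f1 + g1) (f2 + g2).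
Proof.
  intros Hf Hg.
  assert (H : differentiable_pt_lim Rplus (f x y) (g x y) 1 1).
  { intros eps. exists eps. intros u v _ _.
    replace (u + v - (f x y + g x y) - (1 * (u - f x y) + 1 * (v - g x y))) with 0 by ring.
    rewrite Rabs_R0. apply Rmult_le_pos; [apply Rlt_le, cond_pos|].
    eapply Rle_trans; [apply Rabs_pos|apply Rmax_l]. }
  eapply differentiable_lim_eq; [exact (differentiable_pt_lim_comp _ _ _ _ _ _ _ _ _ _ _ H Hf Hg)| |]; simpl; ring.
Qed.

Lemma differentiable_mult f g x y f1 f2 g1 g2 :
  differentiable_pt_lim f x y f1 f2 -> differentiable_pt_lim g x y g1 g2 ->
  differentiable_pt_lim (fun u v => f u v * g u v) x y
    (f1 * g x y + f x y * g1) (f2 * g x y + f x y * g2).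
Proof.
  intros Hf Hg.
  assert (H : differentiable_pt_lim Rmult (f x y) (g x y) (g x y) (f x y)).
  { intros eps. exists eps. intros u v Hu Hv.
    replace (u * v - f x y * g x y - (g x y * (u - f x y) + f x y * (v - g x y)))
      with ((u - f x y) * (v - g x y)) by ring.
    rewrite Rabs_mult. apply Rmult_le_compat; try apply Rabs_pos; [lra|apply Rmax_r]. }
  eapply differentiable_lim_eq; [exact (differentiable_pt_lim_comp _ _ _ _ _ _ _ _ _ _ _ H Hf Hg)| |]; simpl; ring.
Qed.

Lemma differentiable_opp f x y f1 f2 : differentiable_pt_lim f x y f1 f2 ->
  differentiable_pt_lim (fun u v => - f u v) x y (- f1) (- f2).
Proof.
  intros Hf.
  apply differentiable_pt_lim_ext with (fun u v => -1 * f u v).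
  { exists (mkposreal 1 Rlt_0_1). intros; ring. }
  eapply differentiable_lim_eq;
    [exact (differentiable_mult _ _ _ _ _ _ _ _ (differentiable_const (-1) x y) Hf)| |]; simpl; ring.
Qed.

(** Complex differentiability in real terms; with [z = x + i y], the derivative
    is [l + i m]. *)
Definition cauchy_riemann (f : C -> C) (z : C) : Prop := exists l m,
  differentiable_pt_lim (fun x y => Re (f (x, y))) (Re z) (Im z) l (- m) /\
  differentiable_pt_lim (fun x y => Im (f (x, y))) (Re z) (Im z) m l.

Lemma ex_derive_cauchy_riemann (f : C -> C) (z : C) :
  ex_derive (K := C_AbsRing) (V := C_NormedModule) f z -> cauchy_riemann f z.
Proof.
  intros [l [_ Hl]]. exists (Re l), (Im l).
  assert (Hd : forall eps : posreal, locally_2d (fun x y =>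
     Cmod (f (x, y) - f z - ((x, y) - z) * l)%C <= eps * Rmax (Rabs (x - Re z)) (Rabs (y - Im z)))
     (Re z) (Im z)).
  { intros eps.
    assert (He : 0 < eps / 2) by (destruct eps; simpl; lra).
    specialize (Hl z (fun P H => H) (mkposreal _ He)). apply locally_C in Hl.
    destruct Hl as [d Hd]. exists d. intros x y Hx Hy.
    specialize (Hd (x, y)).
    assert (B : ball (M := C_UniformSpace) z d (x, y)).
    { split; simpl; [exact Hx|exact Hy]. }
    specialize (Hd B). simpl in Hd. unfold norm in Hd; simpl in Hd.
    change (Cmod (f (x, y) - f z - ((x, y) - z) * l)%C <= eps / 2 * Cmod ((x, y) - z)%C) in Hd.
    eapply Rle_trans; [exact Hd|].
    pose proof (Cmod_2Rmax ((x, y) - z)%C) as H2. simpl in H2.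
    assert (Hs : sqrt 2 <= 2).
    { rewrite <- (sqrt_square 2) at 2 by lra. apply sqrt_le_1; lra. }
    unfold Re, Im.
    change (x + - fst z) with (x - fst z) in H2. change (y + - snd z) with (y - snd z) in H2.
    set (M := Rmax _ _) in *.
    assert (0 <= M). { eapply Rle_trans; [apply Rabs_pos|apply Rmax_l]. }
    assert (H3 : Cmod ((x, y) - z)%C <= 2 * M) by nra.
    apply (Rmult_le_compat_l (eps / 2)) in H3; [|lra]. lra. }
  destruct z as [a b]. destruct l as [l m]. simpl in *.
  split; intros eps; destruct (Hd eps) as [d Hdd]; exists d; intros x y Hx Hy;
    specialize (Hdd x y Hx Hy); (eapply Rle_trans; [|exact Hdd]);
    pose proof (Rmax_Cmod (f (x, y) - f (a, b) - ((x, y) - (a, b)) * (l, m))%C) as HM.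
  - eapply Rle_trans; [|eapply Rle_trans; [apply Rmax_l|exact HM]].
    right. f_equal. simpl. unfold Re. ring.
  - eapply Rle_trans; [|eapply Rle_trans; [apply Rmax_r|exact HM]].
    right. f_equal. simpl. unfold Im. ring.
Qed.

Lemma cauchy_riemann_const k z : cauchy_riemann (fun _ => k) z.
Proof.
  exists 0, 0. split; (eapply differentiable_lim_eq; [apply differentiable_const| |]; simpl; ring).
Qed.

Lemma cauchy_riemann_id z : cauchy_riemann (fun z => z) z.
Proof.
  exists 1, 0. split; simpl; (eapply differentiable_lim_eq; [apply differentiable_fst || apply differentiable_snd| |]; simpl; ring).
Qed.

Lemma cauchy_riemann_minus f g z : cauchy_riemann f z -> cauchy_riemann g z ->
  cauchy_riemann (fun z => f z - g z)%C z.
Proof.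
  intros (a & b & Hf1 & Hf2) (c & d & Hg1 & Hg2). exists (a - c), (b - d).
  split.
  - eapply differentiable_lim_eq;
      [exact (differentiable_plus _ _ _ _ _ _ _ _ Hf1 (differentiable_opp _ _ _ _ _ Hg1))| |]; simpl; ring.
  - eapply differentiable_lim_eq;
      [exact (differentiable_plus _ _ _ _ _ _ _ _ Hf2 (differentiable_opp _ _ _ _ _ Hg2))| |]; simpl; ring.
Qed.

Lemma cauchy_riemann_mult f g z : cauchy_riemann f z -> cauchy_riemann g z ->
  cauchy_riemann (fun z => f z * g z)%C z.
Proof.
  intros (a & b & Hf1 & Hf2) (c & d & Hg1 & Hg2).
  exists (a * Re (g z) - b * Im (g z) + (c * Re (f z) - d * Im (f z))),
    (b * Re (g z) + a * Im (g z) + (d * Re (f z) + c * Im (f z))).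
  destruct z as [x y]; simpl in *.
  split.
  - eapply differentiable_lim_eq;
      [exact (differentiable_plus _ _ _ _ _ _ _ _ (differentiable_mult _ _ _ _ _ _ _ _ Hf1 Hg1)
                (differentiable_opp _ _ _ _ _ (differentiable_mult _ _ _ _ _ _ _ _ Hf2 Hg2)))| |]; simpl; ring.
  - eapply differentiable_lim_eq;
      [exact (differentiable_plus _ _ _ _ _ _ _ _ (differentiable_mult _ _ _ _ _ _ _ _ Hf1 Hg2)
                (differentiable_mult _ _ _ _ _ _ _ _ Hf2 Hg1))| |]; simpl; ring.
Qed.

Lemma cauchy_riemann_pow f z n : cauchy_riemann f z -> cauchy_riemann (fun z => f z ^ n)%C z.
Proof.
  intros Hf. induction n as [|n IH]; [exact (cauchy_riemann_const (RtoC 1) z)|].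
  exact (cauchy_riemann_mult f (fun z => f z ^ n)%C z Hf IH).
Qed.

Lemma cauchy_riemann_comp f g z : cauchy_riemann f (g z) -> cauchy_riemann g z ->
  cauchy_riemann (fun z => f (g z)) z.
Proof.
  intros (a & b & Hf1 & Hf2) (c & d & Hg1 & Hg2).
  exists (a * c - b * d), (a * d + b * c). destruct z as [x y]; simpl in *.
  assert (E : forall k : C, (Re k, Im k) = k) by now intros [? ?].
  split.
  - eapply differentiable_lim_eq.
    + eapply differentiable_pt_lim_ext;
        [|exact (differentiable_pt_lim_comp _ _ _ _ _ _ _ _ _ _ _ Hf1 Hg1 Hg2)].
      exists (mkposreal 1 Rlt_0_1). intros u v _ _. now rewrite E.
    + ring.
    + ring.
  - eapply differentiable_lim_eq.
    + eapply differentiable_pt_lim_ext;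
        [|exact (differentiable_pt_lim_comp _ _ _ _ _ _ _ _ _ _ _ Hf2 Hg1 Hg2)].
      exists (mkposreal 1 Rlt_0_1). intros u v _ _. now rewrite E.
    + ring.
    + ring.
Qed.

Definition cexp (z : C) : C := (exp (Re z) * cos (Im z), exp (Re z) * sin (Im z)).

Lemma cauchy_riemann_cexp z : cauchy_riemann cexp z.
Proof.
  destruct z as [x y]. exists (exp x * cos y), (exp x * sin y).
  assert (He := differentiable_pt_lim_proj1_0 exp x y _ (derivable_pt_lim_exp x)).
  assert (Hy : forall h l, derivable_pt_lim h y l -> differentiable_pt_lim (fun _ v => h v) x y 0 l).
  { intros h l Hh.
    assert (H := differentiable_pt_lim_proj1_0 h y 0 l Hh).
    eapply differentiable_lim_eq;
     [exact (differentiable_pt_lim_comp _ _ _ x y _ _ _ _ _ _ H (differentiable_snd x y) (differentiable_const 0 x y))| |]; simpl; ring. }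
  split; simpl.
  - eapply differentiable_lim_eq;
      [exact (differentiable_mult _ _ _ _ _ _ _ _ He (Hy _ _ (derivable_pt_lim_cos y)))| |]; simpl; ring.
  - eapply differentiable_lim_eq;
      [exact (differentiable_mult _ _ _ _ _ _ _ _ He (Hy _ _ (derivable_pt_lim_sin y)))| |]; simpl; ring.
Qed.

(** Conjugating before and after keeps a function holomorphic; the inner map here
    is the reflection of the plane in the vertical line through [s / 2]. *)
Lemma cauchy_riemann_reflect f s z : cauchy_riemann f (s - Re z, Im z) ->
  cauchy_riemann (fun z => Cconj (f (s - Re z, Im z))) z.
Proof.
  intros (a & b & Hf1 & Hf2). exists (- a), b. destruct z as [x y]; simpl in *.
  assert (Hx : differentiable_pt_lim (fun u _ => s - u) x y (-1) 0).
  { eapply differentiable_lim_eq;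
      [exact (differentiable_plus _ _ _ _ _ _ _ _ (differentiable_const s x y)
                (differentiable_opp _ _ _ _ _ (differentiable_fst x y)))| |]; simpl; ring. }
  split.
  - eapply differentiable_lim_eq;
      [exact (differentiable_pt_lim_comp (fun x y => Re (f (x, y)))
                (fun u _ => s - u) (fun _ v => v) x y _ _ _ _ _ _ Hf1 Hx (differentiable_snd x y))| |]; simpl; ring.
  - eapply differentiable_lim_eq;
      [exact (differentiable_opp _ _ _ _ _ (differentiable_pt_lim_comp (fun x y => Im (f (x, y)))
                (fun u _ => s - u) (fun _ v => v) x y _ _ _ _ _ _ Hf2 Hx (differentiable_snd x y)))| |]; simpl; ring.
Qed.

Lemma cauchy_riemann_continuous f z : cauchy_riemann f z ->
  continuous (fun z : C_UniformSpace => Re (f z)) z /\ continuous (fun z : C_UniformSpace => Im (f z)) z.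
Proof.
  intros (a & b & Hf1 & Hf2). destruct z as [x y]; simpl in *.
  split.
  - assert (H : continuity_2d_pt (fun x y => Re (f (x, y))) x y).
    { apply differentiable_continuity_pt. now exists a, (- b). }
    apply continuity_2d_pt_filterlim in H. 
    eapply continuous_ext; [|exact H]. now intros [u v].
  - assert (H : continuity_2d_pt (fun x y => Im (f (x, y))) x y).
    { apply differentiable_continuity_pt. now exists b, a. }
    apply continuity_2d_pt_filterlim in H. 
    eapply continuous_ext; [|exact H]. now intros [u v].
Qed.

(** The form is [Im (f dz)], whose closedness is one Cauchy-Riemann equation. *)
Lemma strip_RInt_invariant (f : C -> C) (D : R -> Prop) :
  (forall x x' t, D x -> D x' -> x <= t <= x' -> D t) ->
  (forall z, D (Re z) -> cauchy_riemann f z) ->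
  (forall x, f (x, 2 * PI) = f (x, 0)) ->
  forall a b, D a -> D b ->
  RInt (fun t => Re (f (a, t))) 0 (2 * PI) = RInt (fun t => Re (f (b, t))) 0 (2 * PI).
Proof.
  intros HD Hf Hper a b Ha Hb.
  apply (closed_periodic_form_RInt (fun x y => Im (f (x, y))) (fun x y => Re (f (x, y))) D); try assumption.
  - intros x y Hx. destruct (Hf (x, y) Hx) as (l & m & H1 & H2). simpl in *.
    exists m, l, (- m). now split.
  - pose proof PI_RGT_0; lra.
  - intros x. now rewrite Hper.
Qed.

(** * Circle means of holomorphic functions *)

Definition mean (r : R) (phi : C -> R) : R :=
  / (2 * PI) * RInt (fun t => phi (r * cos t, r * sin t)) 0 (2 * PI).

Definition disk_continuous (phi : C -> R) : Prop :=
  forall z, Cmod z < 1 -> continuous (T := C_UniformSpace) (U := R_UniformSpace) phi z.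

Lemma Cmod_polar r t : 0 <= r -> Cmod (r * cos t, r * sin t) = r.
Proof.
  intros Hr. unfold Cmod; simpl fst; simpl snd.
  replace ((r * cos t) ^ 2 + (r * sin t) ^ 2) with (r * r).
  - now apply sqrt_square.
  - pose proof (sin2_cos2 t) as H. unfold Rsqr in H.
    transitivity (r * r * (sin t * sin t + cos t * cos t)); [rewrite H|]; ring.
Qed.

Lemma disk_continuous_const k : disk_continuous (fun _ => k).
Proof. intros z _. apply continuous_const. Qed.

Lemma disk_continuous_plus f g : disk_continuous f -> disk_continuous g ->
  disk_continuous (fun z => f z + g z).
Proof.
  intros Hf Hg z Hz. exact (continuous_plus (V := R_NormedModule) f g z (Hf z Hz) (Hg z Hz)).
Qed.

Lemma disk_continuous_mult f g : disk_continuous f -> disk_continuous g ->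
  disk_continuous (fun z => f z * g z).
Proof.
  intros Hf Hg z Hz. exact (continuous_mult (K := R_AbsRing) f g z (Hf z Hz) (Hg z Hz)).
Qed.

Lemma disk_continuous_scal k f : disk_continuous f -> disk_continuous (fun z => k * f z).
Proof. apply disk_continuous_mult, disk_continuous_const. Qed.

Lemma disk_continuous_pow f n : disk_continuous f -> disk_continuous (fun z => f z ^ n).
Proof.
  intros Hf. induction n as [|n IH]; [exact (disk_continuous_const 1)|].
  exact (disk_continuous_mult f _ Hf IH).
Qed.

Definition disk_holomorphic (f : C -> C) : Prop := forall z, Cmod z < 1 -> cauchy_riemann f z.

Lemma disk_continuous_Re f : disk_holomorphic f -> disk_continuous (fun z => Re (f z)).
Proof. intros Hf z Hz. apply cauchy_riemann_continuous. auto. Qed.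

Lemma disk_continuous_Im f : disk_holomorphic f -> disk_continuous (fun z => Im (f z)).
Proof. intros Hf z Hz. apply cauchy_riemann_continuous. auto. Qed.

Lemma disk_continuous_Cmod f : disk_holomorphic f -> disk_continuous (fun z => Cmod (f z)).
Proof.
  intros Hf z Hz.
  apply (continuous_comp (fun z => fst (f z) ^ 2 + snd (f z) ^ 2) sqrt).
  - revert z Hz. apply disk_continuous_plus; apply disk_continuous_pow.
    + now apply disk_continuous_Re.
    + now apply disk_continuous_Im.
  - apply continuity_pt_filterlim. apply continuity_pt_sqrt. nra.
Qed.

Lemma disk_holomorphic_minus f g : disk_holomorphic f -> disk_holomorphic g ->
  disk_holomorphic (fun z => f z - g z)%C.
Proof. intros Hf Hg z Hz. apply cauchy_riemann_minus; auto. Qed.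

Lemma disk_holomorphic_mult f g : disk_holomorphic f -> disk_holomorphic g ->
  disk_holomorphic (fun z => f z * g z)%C.
Proof. intros Hf Hg z Hz. apply cauchy_riemann_mult; auto. Qed.

Lemma disk_holomorphic_const k : disk_holomorphic (fun _ => k).
Proof. intros z _. apply cauchy_riemann_const. Qed.

Lemma ex_RInt_circle phi r : disk_continuous phi -> 0 <= r < 1 ->
  ex_RInt (fun t => phi (r * cos t, r * sin t)) 0 (2 * PI).
Proof.
  intros Hphi Hr. apply (ex_RInt_continuous (V := R_CompleteNormedModule)). intros t _.
  apply (continuous_comp_2 (fun t => r * cos t) (fun t => r * sin t) (fun x y => phi (x, y))).
  - apply (continuous_mult (K := R_AbsRing) (fun _ => r) cos); [apply continuous_const|].
    apply continuity_pt_filterlim, continuity_cos.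
  - apply (continuous_mult (K := R_AbsRing) (fun _ => r) sin); [apply continuous_const|].
    apply continuity_pt_filterlim, continuity_sin.
  - apply continuous_ext with phi; [now intros [x y]|].
    apply Hphi. rewrite Cmod_polar; tauto.
Qed.

Lemma mean_plus phi psi r : disk_continuous phi -> disk_continuous psi -> 0 <= r < 1 ->
  mean r (fun z => phi z + psi z) = mean r phi + mean r psi.
Proof.
  intros H1 H2 Hr. unfold mean.
  rewrite (RInt_plus_R (fun t => phi (r * cos t, r * sin t)) (fun t => psi (r * cos t, r * sin t)))
    by now apply ex_RInt_circle.
  ring.
Qed.

Lemma mean_scal k phi r : disk_continuous phi -> 0 <= r < 1 ->
  mean r (fun z => k * phi z) = k * mean r phi.
Proof.
  intros H1 Hr. unfold mean.
  rewrite (RInt_scal_R (fun t => phi (r * cos t, r * sin t)))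
    by now apply ex_RInt_circle.
  ring.
Qed.

Lemma mean_const k r : mean r (fun _ => k) = k.
Proof. unfold mean. rewrite RInt_const_R. pose proof PI_RGT_0. field. lra. Qed.

Lemma mean_le phi psi r : disk_continuous phi -> disk_continuous psi -> 0 <= r < 1 ->
  (forall z, Cmod z = r -> phi z <= psi z) -> mean r phi <= mean r psi.
Proof.
  intros H1 H2 Hr H. unfold mean. pose proof PI_RGT_0.
  apply Rmult_le_compat_l. { left. apply Rinv_0_lt_compat. lra. }
  apply RInt_le; try now apply ex_RInt_circle. lra.
  intros t _. apply H. apply Cmod_polar; tauto.
Qed.

Lemma mean_ext phi psi r : (forall z, phi z = psi z) -> mean r phi = mean r psi.
Proof. intros H. unfold mean. f_equal. apply RInt_ext_R. intros; apply H. Qed.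

Lemma mean_near_origin phi e : disk_continuous phi -> 0 < e ->
  exists d, 0 < d /\ forall r, 0 <= r < 1 -> r < d -> Rabs (mean r phi - phi (RtoC 0)) <= e.
Proof.
  intros Hphi He.
  assert (H0 : Cmod (RtoC 0) < 1) by (rewrite Cmod_0; lra).
  pose proof (proj1 (filterlim_locally phi (phi (RtoC 0))) (Hphi _ H0) (mkposreal e He)) as [d Hd].
  exists d. split; [apply cond_pos|]. intros r Hr Hrd.
  assert (B : forall z, Cmod z = r -> phi (RtoC 0) - e <= phi z <= phi (RtoC 0) + e).
  { intros z Hz. pose proof (Rmax_Cmod z) as Hm. rewrite Hz in Hm.
    assert (Hb : ball (M := C_UniformSpace) (RtoC 0) d z).
    { split.
      - change (Rabs (fst z - 0) < d). rewrite Rminus_0_r. pose proof (Rmax_l (Rabs (fst z)) (Rabs (snd z))). lra.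
      - change (Rabs (snd z - 0) < d). rewrite Rminus_0_r. pose proof (Rmax_r (Rabs (fst z)) (Rabs (snd z))). lra. }
    specialize (Hd z Hb). change (Rabs (phi z - phi (RtoC 0)) < e) in Hd.
    apply Rabs_lt_between in Hd. lra. }
  apply Rabs_le_between.
  assert (Hl : mean r (fun _ => phi (RtoC 0) - e) <= mean r phi).
  { apply mean_le; try assumption; [apply disk_continuous_const|]. intros z Hz. now apply B. }
  assert (Hu : mean r phi <= mean r (fun _ => phi (RtoC 0) + e)).
  { apply mean_le; try assumption; [apply disk_continuous_const|]. intros z Hz. now apply B. }
  rewrite mean_const in Hl, Hu. lra.
Qed.

Lemma Cmod_cexp z : Cmod (cexp z) = exp (Re z).
Proof. apply Cmod_polar. left; apply exp_pos. Qed.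

Lemma exp_lt_1 s : s < 0 -> exp s < 1.
Proof. intros H. rewrite <- exp_0. now apply exp_increasing. Qed.

Lemma cexp_period x : cexp (x, 2 * PI) = cexp (x, 0).
Proof. unfold cexp; simpl. now rewrite cos_2PI, sin_2PI, cos_0, sin_0. Qed.

Lemma mean_origin phi : mean 0 phi = phi (RtoC 0).
Proof.
  unfold mean.
  rewrite (RInt_ext_R _ (fun _ => phi (RtoC 0))) by (intros; f_equal; unfold RtoC; f_equal; ring).
  exact (mean_const (phi (RtoC 0)) 0).
Qed.

(** In the logarithmic coordinate [cexp], circles about the origin become vertical
    segments of length one period, so the mean does not depend on the radius; then
    the radius tends to 0. *)
Lemma mean_value f r : disk_holomorphic f -> 0 <= r < 1 -> mean r (fun z => Re (f z)) = Re (f (RtoC 0)).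
Proof.
  intros Hf Hr.
  destruct (Req_dec r 0) as [->|Hr0]; [exact (mean_origin (fun z => Re (f z)))|].
  assert (Hinv : forall r r', 0 < r < 1 -> 0 < r' < 1 ->
     mean r (fun z => Re (f z)) = mean r' (fun z => Re (f z))).
  { assert (Hln : forall r, 0 < r < 1 -> ln r < 0 /\ exp (ln r) = r).
    { intros s Hs. split; [|now apply exp_ln]. rewrite <- ln_1. now apply ln_increasing. }
    intros r1 r2 H1 H2. destruct (Hln r1 H1) as [H1l H1e]. destruct (Hln r2 H2) as [H2l H2e].
    unfold mean. f_equal. rewrite <- H1e, <- H2e.
    apply (strip_RInt_invariant (fun z => f (cexp z)) (fun x => x < 0)); try assumption.
    - intros; lra.
    - intros z Hz. apply (cauchy_riemann_comp f cexp); [|apply cauchy_riemann_cexp].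
      apply Hf. rewrite Cmod_cexp. now apply exp_lt_1.
    - intros x. now rewrite cexp_period. }
  apply cond_eq. intros e He.
  destruct (mean_near_origin (fun z => Re (f z)) (e / 2)) as (d & Hd & Hmean).
  { now apply disk_continuous_Re. } { lra. }
  rewrite (Hinv r (Rmin (d / 2) (1 / 2))).
  - pose proof (Rmin_l (d / 2) (1 / 2)). pose proof (Rmin_r (d / 2) (1 / 2)).
    assert (0 < Rmin (d / 2) (1 / 2)) by (apply Rmin_pos; lra).
    eapply Rle_lt_trans; [apply Hmean; lra|lra].
  - lra.
  - pose proof (Rmin_r (d / 2) (1 / 2)).
    assert (0 < Rmin (d / 2) (1 / 2)) by (apply Rmin_pos; lra). lra.
Qed.

(** A form of Hadamard's three-circle theorem.  With [G = g o cexp], the function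
    [G(z) * conj (G(s1 + s2 - conj z))] is holomorphic and periodic, so its integral is
    the same on the abscissas [s1] and [(s1 + s2) / 2].  On the second one it is
    [|G|^2]; on the first one it is a product of values of [G] on the abscissas [s1]
    and [s2], at most half the sum of their squared moduli. *)
Lemma mean_square_midpoint g s1 s2 : disk_holomorphic g -> s1 < 0 -> s2 < 0 ->
  2 * mean (exp ((s1 + s2) / 2)) (fun z => Cmod (g z) ^ 2) <=
  mean (exp s1) (fun z => Cmod (g z) ^ 2) + mean (exp s2) (fun z => Cmod (g z) ^ 2).
Proof.
  intros Hg H1 H2. set (u := (s1 + s2) / 2).
  assert (Hc : disk_continuous (fun z => Cmod (g z) ^ 2)).
  { now apply disk_continuous_pow, disk_continuous_Cmod. }
  assert (Hexp : forall s, s < 0 -> 0 <= exp s < 1).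
  { intros s Hs. split; [left; apply exp_pos|now apply exp_lt_1]. }
  set (G := fun z => g (cexp z)).
  assert (HG : forall z, Re z < 0 -> cauchy_riemann G z).
  { intros z Hz. apply (cauchy_riemann_comp g cexp); [|apply cauchy_riemann_cexp].
    apply Hg. rewrite Cmod_cexp. now apply exp_lt_1. }
  set (Pr := fun z : C => (G z * Cconj (G ((s1 + s2 - Re z)%R, Im z)))%C).
  assert (Hinv : RInt (fun t => Re (Pr (s1, t))) 0 (2 * PI) = RInt (fun t => Re (Pr (u, t))) 0 (2 * PI)).
  { apply (strip_RInt_invariant Pr (fun x => s1 + s2 < x < 0)).
    - intros; lra.
    - intros z Hz. apply (cauchy_riemann_mult G (fun z => Cconj (G ((s1 + s2 - Re z)%R, Im z)))); [apply HG; tauto|].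
      apply cauchy_riemann_reflect. apply HG. simpl. lra.
    - intros x. unfold Pr, G; simpl. now rewrite !cexp_period.
    - lra.
    - unfold u; lra. }
  assert (Hu : RInt (fun t => Re (Pr (u, t))) 0 (2 * PI) =
     RInt (fun t => Cmod (g (exp u * cos t, exp u * sin t)) ^ 2) 0 (2 * PI)).
  { apply RInt_ext_R. intros t. unfold Pr, G. simpl Re. simpl Im.
    replace (s1 + s2 - u) with u by (unfold u; lra). unfold cexp. simpl fst; simpl snd.
    rewrite Cmod2_alt. unfold Re, Im. simpl. ring. }
  assert (Hle : 2 * RInt (fun t => Re (Pr (s1, t))) 0 (2 * PI) <=
     RInt (fun t => Cmod (g (exp s1 * cos t, exp s1 * sin t)) ^ 2) 0 (2 * PI) +
     RInt (fun t => Cmod (g (exp s2 * cos t, exp s2 * sin t)) ^ 2) 0 (2 * PI)).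
  { assert (E1 := ex_RInt_circle _ (exp s1) Hc (Hexp s1 H1)).
    assert (E2 := ex_RInt_circle _ (exp s2) Hc (Hexp s2 H2)).
    assert (E3 : ex_RInt (fun t => Re (Pr (s1, t))) 0 (2 * PI)).
    { apply (ex_RInt_dy (fun x y => Im (Pr (x, y))) (fun x y => Re (Pr (x, y))) (fun x => s1 + s2 < x < 0)); [|lra].
      intros x y Hx.
      destruct (cauchy_riemann_mult G (fun z => Cconj (G ((s1 + s2 - Re z)%R, Im z))) (x, y)) as (l & m & h1 & h2).
      - now apply HG.
      - apply cauchy_riemann_reflect. apply HG. simpl. lra.
      - exists m, l, (- m). split; assumption. }
    rewrite <- (RInt_plus_R (fun t => Cmod (g (exp s1 * cos t, exp s1 * sin t)) ^ 2)
      (fun t => Cmod (g (exp s2 * cos t, exp s2 * sin t)) ^ 2)) by assumption.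
    rewrite <- RInt_scal_R by assumption.
    apply RInt_le.
    - pose proof PI_RGT_0; lra.
    - exact (ex_RInt_scal (V := R_NormedModule) _ _ _ 2 E3).
    - now apply ex_RInt_plus_R.
    - intros t _. unfold Pr, G. simpl Re. simpl Im.
      replace (s1 + s2 - s1) with s2 by lra. unfold cexp. simpl fst; simpl snd.
      rewrite !Cmod2_alt. unfold Re, Im. simpl.
      set (a := fst (g (exp s1 * cos t, exp s1 * sin t))).
      set (b := snd (g (exp s1 * cos t, exp s1 * sin t))).
      set (c := fst (g (exp s2 * cos t, exp s2 * sin t))).
      set (d := snd (g (exp s2 * cos t, exp s2 * sin t))).
      pose proof (pow2_ge_0 (a - c)). pose proof (pow2_ge_0 (b - d)). lra. }
  rewrite Hinv, Hu in Hle. unfold mean.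
  assert (HP : 0 < / (2 * PI)). { apply Rinv_0_lt_compat. pose proof PI_RGT_0; lra. }
  apply (Rmult_le_compat_l (/ (2 * PI))) in Hle; [|lra]. unfold u in *. lra.
Qed.

(** The mean is midpoint convex in [ln r] and bounded as [ln r] tends to minus
    infinity. *)
Lemma mean_square_monotone g r R : disk_holomorphic g -> 0 <= r <= R -> R < 1 ->
  mean r (fun z => Cmod (g z) ^ 2) <= mean R (fun z => Cmod (g z) ^ 2).
Proof.
  intros Hg Hr HR.
  assert (Hc : disk_continuous (fun z => Cmod (g z) ^ 2)).
  { now apply disk_continuous_pow, disk_continuous_Cmod. }
  set (m := fun s => mean (exp s) (fun z => Cmod (g z) ^ 2)).
  (* If m (s - d) exceeded m s, midpoint convexity would make m grow at least
     linearly along s - n d, whereas it tends to |g(0)|^2 there. *)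
  assert (Hmono : forall s d, s < 0 -> 0 < d -> m (s - d) <= m s).
  { intros s d Hs Hd. apply Rnot_lt_le. intros Hlt.
    set (e := m (s - d) - m s). assert (He : 0 < e) by (unfold e; lra).
    assert (Hstep : forall n, e <= m (s - INR (S n) * d) - m (s - INR n * d)).
    { induction n as [|n IH].
      - simpl. replace (s - 1 * d) with (s - d) by ring. replace (s - 0 * d) with s by ring. apply Rle_refl.
      - assert (Hn : 0 <= INR n) by apply pos_INR.
        pose proof (mean_square_midpoint g (s - INR n * d) (s - INR (S (S n)) * d) Hg) as H.
        replace ((s - INR n * d + (s - INR (S (S n)) * d)) / 2) with (s - INR (S n) * d) in H
          by (rewrite !S_INR; field).
        fold (m (s - INR (S n) * d)) in H. fold (m (s - INR n * d)) in H.
        fold (m (s - INR (S (S n)) * d)) in H.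
        rewrite !S_INR in *. specialize (H ltac:(nra) ltac:(nra)). lra. }
    assert (Hlin : forall n, m s + INR n * e <= m (s - INR n * d)).
    { induction n as [|n IH].
      - simpl. replace (s - 0 * d) with s by ring. lra.
      - specialize (Hstep n). rewrite S_INR in *. lra. }
    destruct (mean_near_origin _ 1 Hc Rlt_0_1) as (dl & Hdl & Hnear).
    set (K := Cmod (g (RtoC 0)) ^ 2 + 1 - m s).
    destruct (INR_unbounded (Rmax (K / e) ((s - ln dl) / d))) as [n Hn].
    pose proof (Rmax_l (K / e) ((s - ln dl) / d)). pose proof (Rmax_r (K / e) ((s - ln dl) / d)).
    assert (A1 : K < INR n * e). { apply Rlt_div_l; lra. }
    assert (A2 : s - ln dl < INR n * d). { apply Rlt_div_l; lra. }
    specialize (Hlin n).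
    assert (A3 : exp (s - INR n * d) < dl).
    { rewrite <- (exp_ln dl) by assumption. apply exp_increasing. lra. }
    assert (A4 : 0 <= INR n) by apply pos_INR.
    specialize (Hnear (exp (s - INR n * d))).
    fold (m (s - INR n * d)) in Hnear.
    assert (A5 : 0 <= exp (s - INR n * d) < 1).
    { split; [left; apply exp_pos|apply exp_lt_1; nra]. }
    specialize (Hnear A5 A3). apply Rabs_le_between in Hnear. unfold K in A1. lra. }
  destruct (Req_dec r 0) as [->|Hr0].
  - rewrite mean_origin.
    set (k := g (RtoC 0)).
    assert (Hh : disk_holomorphic (fun z => Cconj k * g z)%C).
    { apply disk_holomorphic_mult; [apply disk_holomorphic_const|exact Hg]. }
    pose proof (mean_value _ R Hh (conj (proj2 Hr) HR)) as Hmv.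
    assert (Hd := disk_continuous_Re _ Hh).
    assert (H : mean R (fun z => 2 * Re (Cconj k * g z)%C + - Cmod k ^ 2) <= mean R (fun z => Cmod (g z) ^ 2)).
    { apply mean_le; [|exact Hc|lra|].
      - apply disk_continuous_plus; [now apply disk_continuous_scal|apply disk_continuous_const].
      - intros z _. rewrite !Cmod2_alt. unfold Re, Im; simpl.
        pose proof (pow2_ge_0 (fst k - fst (g z))). pose proof (pow2_ge_0 (snd k - snd (g z))). lra. }
    rewrite mean_plus, mean_scal, mean_const, Hmv in H;
      try lra; try assumption; [|now apply disk_continuous_scal|apply disk_continuous_const].
    fold k in H. rewrite !Cmod2_alt in *. unfold Re, Im in *; simpl in *. lra.
  - destruct (Req_dec r R) as [->|HrR]; [lra|].
    assert (E1 : exp (ln r) = r) by (apply exp_ln; lra).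
    assert (E2 : exp (ln R) = R) by (apply exp_ln; lra).
    assert (ln R < 0) by (rewrite <- ln_1; apply ln_increasing; lra).
    assert (ln r < ln R) by (apply ln_increasing; lra).
    specialize (Hmono (ln R) (ln R - ln r)). unfold m in Hmono.
    replace (ln R - (ln R - ln r)) with (ln r) in Hmono by ring.
    rewrite E1, E2 in Hmono. apply Hmono; lra.
Qed.

(** * Elementary inequalities *)

Lemma bernoulli T n : -1 <= T -> 1 + INR n * T <= (1 + T) ^ n.
Proof.
  intros HT. induction n as [|n IH]; [simpl; lra|].
  rewrite S_INR. simpl pow. pose proof (pos_INR n). 
  assert (0 <= INR n * (T * T)) by (apply Rmult_le_pos; nra).
  apply (Rmult_le_compat_l (1 + T)) in IH; lra.
Qed.

Lemma bernoulli_with_top_term T n : 0 <= T -> 1 + INR (n + 2) * T + T ^ (n + 2) <= (1 + T) ^ (n + 2).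
Proof.
  intros HT. induction n as [|n IH]; [simpl; lra|].
  replace (S n + 2)%nat with (S (n + 2)) by lia.
  rewrite S_INR. simpl pow. pose proof (pos_INR (n + 2)).
  assert (0 <= INR (n + 2) * (T * T)) by (apply Rmult_le_pos; nra).
  assert (0 <= T ^ (n + 2)) by now apply pow_le.
  apply (Rmult_le_compat_l (1 + T)) in IH; lra.
Qed.

(** With [x = |h|] and [b = Re h], this bounds [|1 - h|^(2(n+2))] from below by its
    tangent plane at [h = 0] plus a multiple of [|h|^2 + |h|^(2(n+2))].  For
    [x <= 4] Bernoulli's inequality already leaves a multiple of [x^2], which
    dominates the higher power; for [x >= 4] the top term of the binomial expansion
    provides that power. *)
Lemma power_convexity_defect x b n : 0 <= x -> Rabs b <= x ->
  1 - INR (n + 2) * (2 * b) + / (2 * 16 ^ (n + 2)) * (x ^ 2 + (x ^ 2) ^ (n + 2)) <=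
  (1 + (x ^ 2 - 2 * b)) ^ (n + 2).
Proof.
  intros Hx Hb. apply Rabs_le_between in Hb.
  set (k := (n + 2)%nat). set (T := x ^ 2 - 2 * b).
  assert (H16 : 1 <= 16 ^ k) by (apply pow_R1_Rle; lra).
  assert (Hk : 1 <= INR k) by (unfold k; rewrite plus_INR; simpl; pose proof (pos_INR n); lra).
  set (c := / (2 * 16 ^ k)).
  assert (Hc : c * (2 * 16 ^ k) = 1) by (unfold c; field; lra).
  assert (Hc0 : 0 < c) by (apply Rinv_0_lt_compat; lra).
  assert (Hxx : 0 <= x ^ 2) by apply pow2_ge_0.
  destruct (Rle_dec 4 x) as [H4|H4].
  - assert (HT : x ^ 2 / 2 <= T) by (unfold T; nra).
    pose proof (bernoulli_with_top_term T n ltac:(lra)) as HB. fold k in HB.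
    assert (HTk : (x ^ 2 / 2) ^ k <= T ^ k) by (apply pow_incr; lra).
    assert (Hpk : (x ^ 2) ^ k = 2 ^ k * (x ^ 2 / 2) ^ k).
    { rewrite <- Rpow_mult_distr. f_equal. field. }
    assert (H2 : 2 ^ k <= 16 ^ k) by (apply pow_incr; lra).
    assert (Hq : 0 <= (x ^ 2 / 2) ^ k) by (apply pow_le; lra).
    assert (c * (x ^ 2) ^ k <= (x ^ 2 / 2) ^ k).
    { rewrite Hpk. rewrite <- (Rmult_1_l ((x ^ 2 / 2) ^ k)) at 2. rewrite <- Rmult_assoc.
      apply Rmult_le_compat_r; nra. }
    assert (c * x ^ 2 <= INR k * x ^ 2) by (apply Rmult_le_compat_r; nra).
    unfold T in *; lra.
  - pose proof (bernoulli T k) as HB.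
    assert (HT : -1 <= T) by (unfold T; pose proof (pow2_ge_0 (x - 1)); lra). specialize (HB HT).
    assert (Hpk : (x ^ 2) ^ k <= 16 ^ k * x ^ 2).
    { unfold k. replace (n + 2)%nat with (S (S n)) by lia.
      change ((x ^ 2) ^ S (S n)) with (x ^ 2 * (x ^ 2) ^ S n).
      change (16 ^ S (S n)) with (16 * 16 ^ S n).
      assert (0 <= (x ^ 2) ^ S n <= 16 ^ S n).
      { split; [now apply pow_le|apply pow_incr; split; nra]. }
      nra. }
    apply (Rmult_le_compat_l c) in Hpk; [|lra].
    assert (c * x ^ 2 <= / 2 * x ^ 2) by (apply Rmult_le_compat_r; nra).
    assert (c * (16 ^ k * x ^ 2) = / 2 * x ^ 2).
    { replace (c * (16 ^ k * x ^ 2)) with (c * (2 * 16 ^ k) * (/ 2 * x ^ 2)) by field. rewrite Hc; ring. }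
    assert (x ^ 2 <= INR k * x ^ 2) by nra.
    unfold T in *; lra.
Qed.

(** Taylor's formula at order one with a remainder of order [t^2], uniform in [T]. *)
Lemma power_second_order s T B t m : 0 <= s -> 0 <= B -> 0 <= t <= 1 -> Rabs T <= t * B ->
  0 <= s + T ->
  Rabs ((s + T) ^ (m + 1) - s ^ (m + 1) - INR (m + 1) * s ^ m * T) <= t ^ 2 * (s + B) ^ (m + 1).
Proof.
  intros HS HB Ht HT HST.
  (* the remainders at T and at B obey the same recursion in the exponent, whose
     coefficients are nonnegative and larger at B *)
  assert (main : Rabs ((s + T) ^ (m + 1) - s ^ (m + 1) - INR (m + 1) * s ^ m * T) <=
     t ^ 2 * ((s + B) ^ (m + 1) - s ^ (m + 1) - INR (m + 1) * s ^ m * B)).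
  { induction m as [|m IH].
    - simpl. replace ((s + T) * 1 - s * 1 - 1 * 1 * T) with 0 by ring.
      rewrite Rabs_R0. right; ring.
    - replace (S m + 1)%nat with (S (m + 1)) by lia.
      set (D := fun U => (s + U) ^ (m + 1) - s ^ (m + 1) - INR (m + 1) * s ^ m * U) in *.
      fold (D T) in IH. fold (D B) in IH.
      assert (Hrec : forall U, (s + U) ^ S (m + 1) - s ^ S (m + 1)
          - INR (S (m + 1)) * s ^ S m * U
          = (s + U) * D U + INR (m + 1) * s ^ m * (U * U)).
      { intros U. unfold D. rewrite (S_INR (m + 1)). rewrite <- !tech_pow_Rmult.
        replace (s ^ (m + 1)) with (s * s ^ m) by (rewrite Nat.add_1_r; reflexivity). ring. }
      rewrite !Hrec.
      assert (HSm : 0 <= INR (m + 1) * s ^ m).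
      { apply Rmult_le_pos; [apply pos_INR|now apply pow_le]. }
      eapply Rle_trans; [apply Rabs_triang|].
      rewrite !Rabs_mult, (Rabs_pos_eq (s + T)), (Rabs_pos_eq (INR (m + 1))),
        (Rabs_pos_eq (s ^ m)) by (assumption || apply pos_INR || now apply pow_le).
      assert (H1 : s + T <= s + B).
      { apply Rabs_le_between in HT. nra. }
      assert (H2 : Rabs T * Rabs T <= t ^ 2 * (B * B)).
      { pose proof (Rabs_pos T). replace (t ^ 2 * (B * B)) with ((t * B) * (t * B)) by ring.
        apply Rmult_le_compat; assumption. }
      apply (Rmult_le_compat_l (INR (m + 1) * s ^ m)) in H2; [|assumption].
      assert (H3 : (s + T) * Rabs (D T) <= (s + B) * (t ^ 2 * D B)).
      { apply Rmult_le_compat; try assumption. apply Rabs_pos. }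
      unfold D in *. lra. }
  eapply Rle_trans; [exact main|]. apply Rmult_le_compat_l; [apply pow2_ge_0|].
  assert (0 <= s ^ (m + 1)) by now apply pow_le.
  assert (0 <= INR (m + 1) * s ^ m * B).
  { apply Rmult_le_pos; [apply Rmult_le_pos; [apply pos_INR|now apply pow_le]|assumption]. }
  lra.
Qed.

Lemma pow_one_plus_bound x n : 0 <= x -> (1 + x) ^ (n + 1) - 1 <= 2 ^ (n + 1) * (x + x ^ (n + 1)).
Proof.
  intros Hx. assert (H2 : 1 <= 2 ^ (n + 1)) by (apply pow_R1_Rle; lra).
  destruct (Rle_dec x 1) as [H1|H1].
  - assert (forall k, (1 + x) ^ k - 1 <= 2 ^ k * x).
    { induction k as [|k IH]; simpl; [lra|].
      assert (1 <= 2 ^ k) by (apply pow_R1_Rle; lra).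
      assert ((1 + x) ^ k * x <= 2 ^ k * x).
      { apply Rmult_le_compat_r; [lra|]. apply pow_incr; lra. }
      nra. }
    specialize (H (n + 1)%nat). assert (0 <= x ^ (n + 1)) by now apply pow_le. nra.
  - assert ((1 + x) ^ (n + 1) <= 2 ^ (n + 1) * x ^ (n + 1)).
    { rewrite <- Rpow_mult_distr. apply pow_incr; lra. }
    nra.
Qed.

Lemma Cmod_product_near_one (P W : C) a x : Cmod (P - 1) <= a - 1 -> Cmod (W - 1) <= x ->
  Cmod (P * W - 1) <= a * (1 + x) - 1.
Proof.
  intros HP HW.
  replace (P * W - 1)%C with (P * (W - 1) + (P - 1))%C by ring.
  eapply Rle_trans; [apply Cmod_triangle|]. rewrite Cmod_mult.
  assert (HPa : Cmod P <= a).
  { replace P with (1 + (P - 1))%C by ring. eapply Rle_trans; [apply Cmod_triangle|].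
    rewrite Cmod_1. lra. }
  assert (Cmod P * Cmod (W - 1) <= a * x).
  { apply Rmult_le_compat; try apply Cmod_ge_0; assumption. }
  lra.
Qed.

(** [|u|^(2m) conj u] is the integrand of the derivative of the [2(m+1)]-th power of
    the norm at [u = 1 - h]: a product of [2m + 1] factors, each within [|h|] of 1. *)
Lemma duality_map_near_one (h : C) m :
  Cmod ((Cmod (1 - h) ^ 2) ^ m * Cconj (1 - h) - 1)%C <=
  2 ^ (2 * m + 1) * (Cmod h + Cmod h ^ (2 * m + 1)).
Proof.
  set (x := Cmod h). set (u := (1 - h)%C).
  assert (Hx : 0 <= x) by apply Cmod_ge_0.
  assert (Hu : Cmod (u - 1) <= x).
  { replace (u - 1)%C with (- h)%C by (unfold u; ring). rewrite Cmod_opp. apply Rle_refl. }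
  assert (Hc : Cmod (Cconj u - 1) <= x).
  { replace (Cconj u - 1)%C with (Cconj (u - 1)).
    - now rewrite Cmod_conj.
    - rewrite Cminus_conj. f_equal. unfold Cconj, RtoC; simpl. f_equal; ring. }
  eapply Rle_trans; [|now apply pow_one_plus_bound].
  replace ((1 + x) ^ (2 * m + 1)) with ((1 + x) ^ (2 * m) * (1 + x)) by (rewrite pow_add; ring).
  apply Cmod_product_near_one; [|exact Hc].
  rewrite <- !RtoC_pow.
  induction m as [|m IH].
  - simpl. replace (1 - 1)%C with (RtoC 0) by ring. rewrite Cmod_0. lra.
  - replace (2 * S m)%nat with (2 * m + 2)%nat by lia.
    replace ((1 + x) ^ (2 * m + 2)) with ((1 + x) ^ (2 * m) * (1 + x) * (1 + x))
      by (rewrite pow_add; ring).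
    replace (RtoC ((Cmod u ^ 2) ^ S m)) with ((RtoC ((Cmod u ^ 2) ^ m) * u * Cconj u)%C).
    + apply Cmod_product_near_one; [|exact Hc]. now apply Cmod_product_near_one.
    + rewrite <- Cmult_assoc, <- Cmod2_conj. rewrite !RtoC_pow, <- RtoC_pow.
      rewrite <- !RtoC_pow. rewrite <- RtoC_mult. f_equal. simpl; ring.
Qed.

(** * The residual and its perturbations *)

Lemma Cmod_minus_sq (u v : C) : Cmod (u - v) ^ 2 = Cmod u ^ 2 + (Cmod v ^ 2 - 2 * Re (Cconj u * v)).
Proof. rewrite !Cmod2_alt. destruct u, v. unfold Re, Im; simpl. ring. Qed.

Lemma Re_ge_opp_Cmod (z : C) : - Cmod z <= Re z.
Proof. pose proof (re_le_Cmod z) as H. apply Rabs_le_between in H. lra. Qed.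

Definition defect_constant (n : nat) : R := / (2 * 16 ^ (n + 2)).

(** Up to the factor 4, the reciprocal of the lower bound for [|w|]. *)
Definition root_constant (n : nat) : R :=
  INR (2 * (n + 2)) * 2 ^ (2 * (n + 1) + 1) / defect_constant n.

Lemma defect_constant_pos n : 0 < defect_constant n.
Proof. apply Rinv_0_lt_compat. pose proof (pow_lt 16 (n + 2)). lra. Qed.

Lemma root_constant_pos n : 0 < root_constant n.
Proof.
  apply Rdiv_lt_0_compat; [|apply defect_constant_pos].
  apply Rmult_lt_0_compat; [apply lt_0_INR; lia|apply pow_lt; lra].
Qed.

Lemma residual_size_bound (h : C) n :
  defect_constant n * (Cmod h ^ 2 + Cmod h ^ (2 * (n + 2))) <=
  Cmod (1 - h) ^ (2 * (n + 2)) - 1 + INR (2 * (n + 2)) * Re h.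
Proof.
  pose proof (power_convexity_defect (Cmod h) (Re h) n (Cmod_ge_0 h) (re_le_Cmod h)) as H.
  rewrite !pow_mult, mult_INR. fold (defect_constant n) in H.
  replace (Cmod (1 - h) ^ 2) with (1 + (Cmod h ^ 2 - 2 * Re h)).
  - simpl INR. simpl INR in H. lra.
  - rewrite Cmod_minus_sq, Cmod_1. destruct h; unfold Re, RtoC; simpl. ring.
Qed.

(** First-order expansion of [|(1 - h) - t e f|^p] in [t], where the derivative
    [-p Re(e f |u|^(p-2) conj u)] at [u = 1 - h] is replaced by [-p Re(e f)].  By
    [duality_map_near_one] and the hypothesis on [f], this costs a multiple of
    [|h|^2 + |h|^p], and that is at most a multiple of [|u|^p - 1 + p Re h].
    In the mean over a circle, [|u|^p - 1] will be nonpositive and [Re h] will become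
    its value at the origin. *)
Lemma perturbed_residual_bound (h f e : C) (t A : R) n :
  Cmod e = 1 -> 0 <= t <= 1 -> 0 <= A ->
  Cmod f * (Cmod h + Cmod h ^ (2 * (n + 1) + 1)) <= A * (Cmod h ^ 2 + Cmod h ^ (2 * (n + 2))) ->
  Cmod (1 - h - t * (e * f)) ^ (2 * (n + 2)) <=
  Cmod (1 - h) ^ (2 * (n + 2)) - INR (2 * (n + 2)) * t * Re (e * f)
  + t * (root_constant n * A) * (Cmod (1 - h) ^ (2 * (n + 2)) - 1 + INR (2 * (n + 2)) * Re h)
  + t ^ 2 * (INR (n + 3) * (Cmod (1 - h) + Cmod f) ^ (2 * (n + 2))).
Proof.
  intros He Ht HA Hf.
  pose proof (residual_size_bound h n) as Hsize.
  pose proof (duality_map_near_one h (n + 1)) as Hdual.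
  set (u := (1 - h)%C) in *.
  set (k := INR (2 * (n + 2))) in *.
  set (s := Cmod u ^ 2). set (W := (e * f)%C).
  assert (HW : Cmod W = Cmod f) by (unfold W; rewrite Cmod_mult, He; ring).
  set (B := Cmod f ^ 2 + 2 * Cmod u * Cmod f).
  pose proof (Cmod_ge_0 u) as Hu0. pose proof (Cmod_ge_0 f) as Hf0.
  assert (HS : 0 <= s) by apply pow2_ge_0.
  assert (HB : 0 <= B) by (unfold B; nra).
  set (T := Cmod (t * W) ^ 2 - 2 * Re (Cconj u * (t * W))).
  assert (HtW : Cmod (t * W) = t * Cmod f).
  { rewrite Cmod_mult, HW, Cmod_R, Rabs_pos_eq by tauto. reflexivity. }
  assert (HRe : Re (Cconj u * (t * W)) = t * Re (Cconj u * W)).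
  { destruct u, W; unfold Re, Cconj; simpl; ring. }
  assert (HuW : Rabs (Re (Cconj u * W)) <= Cmod u * Cmod f).
  { eapply Rle_trans; [apply re_le_Cmod|]. rewrite Cmod_mult, Cmod_conj, HW. apply Rle_refl. }
  assert (HT : Rabs T <= t * B).
  { unfold T. rewrite HtW, HRe. apply Rabs_le_between in HuW. apply Rabs_le.
    assert (t ^ 2 * Cmod f ^ 2 <= t * Cmod f ^ 2).
    { apply Rmult_le_compat_r; [apply pow2_ge_0|nra]. }
    assert (0 <= t ^ 2 * Cmod f ^ 2).
    { apply Rmult_le_pos; apply pow2_ge_0. }
    replace ((t * Cmod f) ^ 2) with (t ^ 2 * Cmod f ^ 2) by ring.
    unfold B. split; nra. }
  assert (HST : Cmod (u - t * W) ^ 2 = s + T) by (rewrite Cmod_minus_sq; reflexivity).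
  pose proof (power_second_order s T B t (n + 1) HS HB Ht HT) as Hexp.
  rewrite <- HST in Hexp. specialize (Hexp (pow2_ge_0 _)).
  replace (n + 1 + 1)%nat with (n + 2)%nat in Hexp by lia.
  apply Rabs_le_between in Hexp. destruct Hexp as [_ Hexp].
  assert (HSB : s + B = (Cmod u + Cmod f) ^ 2) by (unfold s, B; ring).
  assert (HSf : s ^ (n + 1) * Cmod f ^ 2 <= (s + B) ^ (n + 2)).
  { replace (n + 2)%nat with (S (n + 1)) by lia. simpl pow at 3. rewrite Rmult_comm.
    apply Rmult_le_compat; [apply pow2_ge_0|now apply pow_le| |apply pow_incr; lra].
    unfold B; nra. }
  (* the linear term is the pairing with the duality map of u, which is close to 1 *)
  assert (Hlin : Re W - 2 ^ (2 * (n + 1) + 1) * (A * (Cmod h ^ 2 + Cmod h ^ (2 * (n + 2))))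
                 <= s ^ (n + 1) * Re (Cconj u * W)).
  { replace (s ^ (n + 1) * Re (Cconj u * W)) with
      (Re W + Re (((Cmod u ^ 2) ^ (n + 1) * Cconj u - 1) * W)%C).
    - pose proof (Re_ge_opp_Cmod (((Cmod u ^ 2) ^ (n + 1) * Cconj u - 1) * W)%C) as H.
      rewrite Cmod_mult, HW in H.
      apply (Rmult_le_compat_r (Cmod f)) in Hdual; [|assumption].
      apply (Rmult_le_compat_l (2 ^ (2 * (n + 1) + 1))) in Hf; [|apply pow_le; lra].
      lra.
    - rewrite <- !RtoC_pow. fold s. destruct u, W; unfold Re, Cconj, RtoC; simpl; ring. }
  assert (Hk : INR (n + 2) * 2 = k) by (unfold k; rewrite mult_INR; simpl INR; ring).
  assert (Hk0 : 0 <= k) by apply pos_INR.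
  assert (Hroot : k * 2 ^ (2 * (n + 1) + 1) * (A * (Cmod h ^ 2 + Cmod h ^ (2 * (n + 2)))) <=
     root_constant n * A * (Cmod u ^ (2 * (n + 2)) - 1 + k * Re h)).
  { unfold root_constant. fold k.
    apply (Rmult_le_compat_l (k * 2 ^ (2 * (n + 1) + 1) / defect_constant n * A)) in Hsize.
    - pose proof (defect_constant_pos n). eapply Rle_trans; [|exact Hsize].
      right. field. lra.
    - apply Rmult_le_pos; [|assumption]. left; apply root_constant_pos. }
  rewrite !pow_mult in *. rewrite <- HSB. fold s in Hroot, Hexp |- *. fold s.
  assert (Hk3 : INR (n + 3) = INR (n + 2) + 1) by (rewrite !plus_INR; simpl; ring).
  assert (Hkn : 0 <= INR (n + 2)) by apply pos_INR.
  replace (INR (n + 2) * s ^ (n + 1) * T) with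
    (t ^ 2 * (INR (n + 2) * (s ^ (n + 1) * Cmod f ^ 2)) - k * t * (s ^ (n + 1) * Re (Cconj u * W))) in Hexp
    by (unfold T; rewrite HtW, HRe, <- Hk; ring).
  apply (Rmult_le_compat_l (t ^ 2 * INR (n + 2))) in HSf;
    [|apply Rmult_le_pos; [apply pow2_ge_0|assumption]].
  apply (Rmult_le_compat_l (k * t)) in Hlin; [|apply Rmult_le_pos; tauto].
  apply (Rmult_le_compat_l t) in Hroot; [|tauto].
  rewrite Hk3. lra.
Qed.

(** * Norms in the Hardy space *)

Lemma rpow_INR x n : 0 <= x -> (0 < n)%nat -> rpow x (INR n) = x ^ n.
Proof.
  intros Hx Hn. unfold rpow. destruct (Req_EM_T x 0) as [->|Hx0].
  - symmetry; apply pow_i; lia.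
  - apply Rpower_pow. lra.
Qed.

Lemma rpow_le_inv s t a : 0 <= s -> 0 <= t -> 0 < a -> rpow s a <= rpow t a -> s <= t.
Proof.
  intros Hs Ht Ha H. apply Rnot_lt_le. intros Hlt. revert H. apply Rlt_not_le.
  unfold rpow. destruct (Req_EM_T s 0); [lra|]. destruct (Req_EM_T t 0).
  - apply exp_pos.
  - apply Rlt_Rpower_l; lra.
Qed.

Lemma circle_mean_eq n g r : (0 < n)%nat -> 
  circle_mean (INR n) g r = mean r (fun z => Cmod (g z) ^ n).
Proof.
  intros Hn. apply (mean_ext (fun z => rpow (Cmod (g z)) (INR n))).
  intros z. apply rpow_INR; [apply Cmod_ge_0|assumption].
Qed.

Lemma mean_pow_nonneg g n r : disk_holomorphic g -> 0 <= r < 1 -> 0 <= mean r (fun z => Cmod (g z) ^ n).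
Proof.
  intros Hg Hr. rewrite <- (mean_const 0 r). apply mean_le; try assumption.
  - apply disk_continuous_const.
  - now apply disk_continuous_pow, disk_continuous_Cmod.
  - intros z _. apply pow_le, Cmod_ge_0.
Qed.

Lemma Hp_norm_finite_bounded n g : (0 < n)%nat -> Rbar_lt (Hp_norm (INR n) g) p_infty ->
  exists B, forall r, 0 <= r < 1 -> mean r (fun z => Cmod (g z) ^ n) <= B.
Proof.
  intros Hn H. unfold Hp_norm in H.
  pose proof (Lub_Rbar_correct (fun x => exists r, 0 <= r < 1 /\ x = circle_mean (INR n) g r)) as [Hub _].
  destruct (Lub_Rbar _) as [s| |]; simpl in H.
  - exists s. intros r Hr. rewrite <- circle_mean_eq by assumption.
    apply (Hub (circle_mean (INR n) g r)). now exists r.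
  - easy.
  - exfalso. apply (Hub (circle_mean (INR n) g 0)). exists 0. split; [lra|reflexivity].
Qed.

(** This removes the supremum and the root from the definition of the norm: its
    comparisons are used only through upper bounds for the means. *)
Lemma Hp_norm_le_transfer n g g' B : (0 < n)%nat -> disk_holomorphic g -> disk_holomorphic g' ->
  Rbar_le (Hp_norm (INR n) g) (Hp_norm (INR n) g') ->
  (forall r, 0 <= r < 1 -> mean r (fun z => Cmod (g' z) ^ n) <= B) ->
  forall r, 0 <= r < 1 -> mean r (fun z => Cmod (g z) ^ n) <= B.
Proof.
  intros Hn Hg Hg' Hle HB r Hr. unfold Hp_norm in Hle.
  pose proof (Lub_Rbar_correct (fun x => exists r, 0 <= r < 1 /\ x = circle_mean (INR n) g r)) as [Hub _].
  pose proof (Lub_Rbar_correct (fun x => exists r, 0 <= r < 1 /\ x = circle_mean (INR n) g' r)) as [Hub' Hl'].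
  destruct (Lub_Rbar (fun x => exists r, 0 <= r < 1 /\ x = circle_mean (INR n) g r)) as [s| |];
  destruct (Lub_Rbar (fun x => exists r, 0 <= r < 1 /\ x = circle_mean (INR n) g' r)) as [s'| |];
  try (exfalso; apply (Hub (circle_mean (INR n) g r)); now exists r);
  try (exfalso; apply (Hub' (circle_mean (INR n) g' r)); now exists r);
  try (exfalso; apply (Hl' (Finite B)); intros x (r' & Hr' & ->); simpl;
    rewrite circle_mean_eq by assumption; now apply HB);
  try easy.
  assert (H1 : mean r (fun z => Cmod (g z) ^ n) <= s).
  { rewrite <- circle_mean_eq by assumption. apply (Hub (circle_mean (INR n) g r)). now exists r. }
  assert (H2 : mean r (fun z => Cmod (g' z) ^ n) <= s').
  { rewrite <- circle_mean_eq by assumption. apply (Hub' (circle_mean (INR n) g' r)). now exists r. }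
  assert (H3 : s' <= B).
  { apply (Hl' (Finite B)). intros x (r' & Hr' & ->). simpl.
    rewrite circle_mean_eq by assumption. now apply HB. }
  pose proof (mean_pow_nonneg g n r Hg Hr). pose proof (mean_pow_nonneg g' n r Hg' Hr).
  apply rpow_le_inv in Hle; try lra. apply Rinv_0_lt_compat, lt_0_INR. exact Hn.
Qed.

(** [|g|^(2k)] is the squared modulus of the holomorphic function [g^k]. *)
Lemma mean_even_power_monotone g k r R : disk_holomorphic g -> 0 <= r <= R -> R < 1 ->
  mean r (fun z => Cmod (g z) ^ (2 * k)) <= mean R (fun z => Cmod (g z) ^ (2 * k)).
Proof.
  intros Hg Hr HR.
  assert (E : forall z, Cmod (g z) ^ (2 * k) = Cmod (g z ^ k)%C ^ 2).
  { intros z. rewrite Cmod_pow, <- !pow_mult. f_equal. lia. }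
  rewrite !(mean_ext _ _ _ E). apply mean_square_monotone; try assumption.
  intros z Hz. now apply cauchy_riemann_pow, Hg.
Qed.

(** Small radii can be left out of the hypothesis because the means increase with
    the radius. *)
Lemma minimal_norm_no_uniform_gain k g g' B eta : (0 < k)%nat ->
  disk_holomorphic g -> disk_holomorphic g' ->
  Rbar_le (Hp_norm (INR (2 * k)) g) (Hp_norm (INR (2 * k)) g') ->
  (forall r, 0 <= r < 1 -> mean r (fun z => Cmod (g z) ^ (2 * k)) <= B) ->
  (forall r, 1 / 2 <= r < 1 ->
     mean r (fun z => Cmod (g' z) ^ (2 * k)) <= mean r (fun z => Cmod (g z) ^ (2 * k)) - eta) ->
  eta <= 0.
Proof.
  intros Hk Hg Hg' Hle HB Hgain.
  destruct (completeness (fun x => exists r, 0 <= r < 1 /\ x = mean r (fun z => Cmod (g z) ^ (2 * k))))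
    as [M [HM1 HM2]].
  - exists B. intros x (r & Hr & ->). now apply HB.
  - exists (mean 0 (fun z => Cmod (g z) ^ (2 * k))), 0. split; [lra|reflexivity].
  - assert (H : forall r, 0 <= r < 1 -> mean r (fun z => Cmod (g z) ^ (2 * k)) <= M - eta).
    { apply (Hp_norm_le_transfer (2 * k) g g'); try assumption; [lia|].
      intros r Hr. set (R := Rmax r (1 / 2)).
      pose proof (Rmax_l r (1 / 2)). pose proof (Rmax_r r (1 / 2)).
      assert (HR : R < 1) by (apply Rmax_lub_lt; lra). fold R in H, H0.
      assert (mean R (fun z => Cmod (g z) ^ (2 * k)) <= M) by (apply HM1; exists R; split; [lra|reflexivity]).
      pose proof (mean_even_power_monotone g' k r R Hg' (conj (proj1 Hr) H) HR).
      specialize (Hgain R (conj H0 HR)). lra. }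
    assert (M <= M - eta).
    { apply HM2. intros x (r & Hr & ->). now apply H. }
    lra.
Qed.

(** * The roots of the approximant *)

Lemma poly_le_1_affine (c0 c1 : C) : poly_le 1 (fun z => c0 - c1 * z)%C.
Proof.
  exists (fun k => match k with O => c0 | _ => (- c1)%C end). intros z.
  rewrite sum_Sn, sum_O. simpl. unfold plus; simpl. ring.
Qed.

Lemma exists_rotation (z : C) : exists e : C, Cmod e = 1 /\ Re (e * z) = Cmod z.
Proof.
  destruct (Req_dec (Cmod z) 0) as [H|H].
  - exists (RtoC 1). split; [apply Cmod_1|]. rewrite H. apply Cmod_eq_0 in H. rewrite H. simpl. ring.
  - exists (/ Cmod z * Cconj z)%C. pose proof (Cmod_ge_0 z). split.
    + rewrite Cmod_mult, Cmod_conj, <- RtoC_inv, Cmod_R, Rabs_pos_eq by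
        (try assumption; left; apply Rinv_0_lt_compat; lra). field. assumption.
    + pose proof (Cmod2_conj z) as Hz. rewrite <- RtoC_inv by assumption.
      replace (RtoC (/ Cmod z) * Cconj z * z)%C with (RtoC (/ Cmod z) * (z * Cconj z))%C by ring.
      rewrite <- Hz, <- RtoC_mult. simpl. field. assumption.
Qed.

Lemma sum_pow_le a b n : 0 <= a -> 0 <= b -> (a + b) ^ n <= 2 ^ n * (a ^ n + b ^ n).
Proof.
  intros Ha Hb.
  assert (H : (a + b) ^ n <= (2 * Rmax a b) ^ n).
  { apply pow_incr. pose proof (Rmax_l a b). pose proof (Rmax_r a b). lra. }
  rewrite Rpow_mult_distr in H. eapply Rle_trans; [exact H|].
  apply Rmult_le_compat_l; [apply pow_le; lra|].
  assert (0 <= a ^ n) by now apply pow_le. assert (0 <= b ^ n) by now apply pow_le.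
  unfold Rmax; destruct (Rle_dec a b); lra.
Qed.

(** On circles of radius at least [1/2] one has [|z - w| >= 1/4], hence
    [|f| <= 4 |h| / |a|] for [h = a (z - w) f].  Stating it through [A] also covers
    [a = 0], where both sides vanish. *)
Lemma factor_controlled (a w : C) n : Cmod w <= 1 / 4 -> exists A, 0 <= A /\ A * Cmod a <= 4 /\
  forall z f : C, 1 / 2 <= Cmod z ->
  let x := Cmod (a * (z - w) * f) in
  Cmod f * (x + x ^ (2 * (n + 1) + 1)) <= A * (x ^ 2 + x ^ (2 * (n + 2))).
Proof.
  intros Hw. destruct (Req_dec (Cmod a) 0) as [Ha|Ha].
  - exists 0. rewrite Ha. repeat split; try lra. intros z f Hz x.
    assert (Hx : x = 0) by (unfold x; rewrite !Cmod_mult, Ha; ring).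
    rewrite Hx, Nat.add_1_r. simpl. right. ring.
  - pose proof (Cmod_ge_0 a) as Ha0. exists (4 / Cmod a). repeat split.
    + apply Rdiv_le_0_compat; lra.
    + right; field; assumption.
    + intros z f Hz x. pose proof (Cmod_ge_0 f) as Hf.
      assert (Hzw : 1 / 4 <= Cmod (z - w)).
      { pose proof (Cmod_triangle (z - w) w) as H. replace (z - w + w)%C with z in H by ring. lra. }
      assert (Hx : x = Cmod a * Cmod (z - w) * Cmod f) by (unfold x; now rewrite !Cmod_mult).
      assert (Hx0 : 0 <= x) by apply Cmod_ge_0.
      assert (Hfx : Cmod f <= 4 / Cmod a * x).
      { rewrite Hx. replace (4 / Cmod a * (Cmod a * Cmod (z - w) * Cmod f)) with
          (4 * Cmod (z - w) * Cmod f) by (field; assumption). nra. }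
      replace (2 * (n + 2))%nat with (S (2 * (n + 1) + 1)) by lia.
      replace (4 / Cmod a * (x ^ 2 + x ^ S (2 * (n + 1) + 1))) with
        (4 / Cmod a * x * (x + x ^ (2 * (n + 1) + 1))) by (simpl; ring).
      apply Rmult_le_compat_r; [|assumption].
      assert (0 <= x ^ (2 * (n + 1) + 1)) by now apply pow_le. lra.
Qed.

(** The perturbation [q + t e] of the approximant is tested, with [e] of modulus 1
    turning [f(0)] into a nonnegative number. *)
Lemma OPA_root_bound n (f : C -> C) (a w : C) :
  in_Hp (INR (2 * (n + 2))) f -> f (RtoC 0) <> RtoC 0 ->
  is_OPA 1 (INR (2 * (n + 2))) f (fun z => a * (z - w))%C ->
  Cmod w <= 1 / 4 -> 1 <= 4 * root_constant n * Cmod w.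
Proof.
  intros [Hhol Hfin] Hf0 [_ Hmin] Hw.
  assert (Hf : disk_holomorphic f).
  { intros z Hz. now apply ex_derive_cauchy_riemann, Hhol. }
  set (p := (2 * (n + 2))%nat) in *. assert (Hp : (0 < p)%nat) by (unfold p; lia).
  destruct (Hp_norm_finite_bounded p f Hp Hfin) as [B HB].
  set (h := fun z : C => (a * (z - w) * f z)%C).
  assert (Hh : disk_holomorphic h).
  { repeat apply disk_holomorphic_mult; try assumption; [apply disk_holomorphic_const|].
    apply disk_holomorphic_minus; [intros z _; apply cauchy_riemann_id|apply disk_holomorphic_const]. }
  set (g := fun z : C => (1 - h z)%C).
  assert (Hg : disk_holomorphic g).
  { apply disk_holomorphic_minus; [apply disk_holomorphic_const|assumption]. }
  assert (Hmin' : forall c0 c1 : C, Rbar_le (Hp_norm (INR p) g)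
     (Hp_norm (INR p) (fun z => 1 - (c0 - c1 * z) * f z)%C)).
  { intros c0 c1. apply Hmin, poly_le_1_affine. }
  assert (Hpoly : forall c0 c1 : C, disk_holomorphic (fun z => 1 - (c0 - c1 * z) * f z)%C).
  { intros c0 c1. apply disk_holomorphic_minus; [apply disk_holomorphic_const|].
    apply disk_holomorphic_mult; [|assumption].
    apply disk_holomorphic_minus; [apply disk_holomorphic_const|].
    apply disk_holomorphic_mult; [apply disk_holomorphic_const|].
    intros z _; apply cauchy_riemann_id. }
  assert (Hg1 : forall r, 0 <= r < 1 -> mean r (fun z => Cmod (g z) ^ p) <= 1).
  { apply (Hp_norm_le_transfer p g _ 1 Hp Hg (Hpoly (RtoC 0) (RtoC 0)) (Hmin' (RtoC 0) (RtoC 0))).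
    intros r Hr. right. etransitivity; [|exact (mean_const 1 r)]. apply mean_ext. intros z.
    replace (1 - (0 - 0 * z) * f z)%C with (RtoC 1) by ring. rewrite Cmod_1. apply pow1. }
  destruct (factor_controlled a w n Hw) as (A & HA0 & HA4 & HA).
  destruct (exists_rotation (f (RtoC 0))) as (e & He & Hef).
  set (F := Cmod (f (RtoC 0))) in *.
  assert (HF : 0 < F) by (apply Cmod_gt_0; assumption).
  set (K := INR (n + 3) * (2 ^ p * (1 + B))).
  set (L := root_constant n * A).
  assert (HL : 0 <= L) by (apply Rmult_le_pos; [left; apply root_constant_pos|assumption]).
  assert (Hcg : disk_continuous (fun z => Cmod (g z) ^ p)) by now apply disk_continuous_pow, disk_continuous_Cmod.
  assert (Hcf : disk_continuous (fun z => Cmod (f z) ^ p)) by now apply disk_continuous_pow, disk_continuous_Cmod.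
  assert (Hef' : disk_holomorphic (fun z => e * f z)%C).
  { apply disk_holomorphic_mult; [apply disk_holomorphic_const|assumption]. }
  assert (Hh0 : Re (h (RtoC 0)) <= Cmod a * Cmod w * F).
  { pose proof (re_le_Cmod (h (RtoC 0))) as H. apply Rabs_le_between in H.
    replace (Cmod a * Cmod w * F) with (Cmod (h (RtoC 0))); [tauto|].
    unfold h. replace (0 - w)%C with (- w)%C by ring. now rewrite !Cmod_mult, Cmod_opp. }
  (* first-order gain minus the errors, which minimality forces to be nonpositive *)
  assert (Hgain : forall t, 0 <= t <= 1 ->
     INR p * t * F - t * L * (INR p * (Cmod a * Cmod w * F)) - t ^ 2 * K <= 0).
  { intros t Ht. set (c := (t * e)%C).
    set (g' := fun z : C => (1 - ((c - a * w) - (- a) * z) * f z)%C).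
    assert (Hg' : disk_holomorphic g') by apply Hpoly.
    apply (minimal_norm_no_uniform_gain (n + 2) g g' 1); try assumption.
    - lia.
    - exact (Hmin' (c - a * w)%C (- a)%C).
    - intros r Hr. assert (Hr' : 0 <= r < 1) by lra. fold p.
      set (psi1 := fun z => t * L * Cmod (g z) ^ p + - (t * L)).
      set (psi2 := fun z => t * L * INR p * Re (h z)).
      set (psi3 := fun z => - (INR p * t) * Re (e * f z)).
      set (psi4 := fun z => t ^ 2 * INR (n + 3) * 2 ^ p * (Cmod (g z) ^ p + Cmod (f z) ^ p)).
      assert (C1 : disk_continuous psi1).
      { apply disk_continuous_plus; [now apply disk_continuous_scal|apply disk_continuous_const]. }
      assert (C2 : disk_continuous psi2).
      { now apply disk_continuous_scal, disk_continuous_Re. }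
      assert (C3 : disk_continuous psi3).
      { now apply disk_continuous_scal, disk_continuous_Re. }
      assert (C4 : disk_continuous psi4).
      { now apply disk_continuous_scal, disk_continuous_plus. }
      assert (C12 := disk_continuous_plus _ _ C1 C2).
      assert (C34 := disk_continuous_plus _ _ C3 C4).
      assert (C14 := disk_continuous_plus _ _ C12 C34).
      assert (Hle : mean r (fun z => Cmod (g' z) ^ p) <=
         mean r (fun z => Cmod (g z) ^ p + ((psi1 z + psi2 z) + (psi3 z + psi4 z)))).
      { apply mean_le; try assumption.
        - now apply disk_continuous_pow, disk_continuous_Cmod.
        - now apply disk_continuous_plus.
        - intros z Hz.
          pose proof (perturbed_residual_bound (h z) (f z) e t A n He Ht HA0) as H.
          specialize (H (HA z (f z) ltac:(lra))).
          replace (1 - h z - t * (e * f z))%C with (g' z) in H by (unfold g', h, c; ring).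
          fold (g z) p L in H.
          pose proof (sum_pow_le (Cmod (g z)) (Cmod (f z)) p (Cmod_ge_0 _) (Cmod_ge_0 _)) as H2.
          apply (Rmult_le_compat_l (t ^ 2 * INR (n + 3))) in H2;
            [|apply Rmult_le_pos; [apply pow2_ge_0|apply pos_INR]].
          unfold psi1, psi2, psi3, psi4. lra. }
      rewrite mean_plus in Hle by assumption.
      rewrite (mean_plus (fun z => psi1 z + psi2 z)) in Hle by assumption.
      rewrite (mean_plus psi1), (mean_plus psi3) in Hle by assumption.
      assert (E1 : mean r psi1 <= 0).
      { unfold psi1. rewrite mean_plus, mean_scal, mean_const; try assumption.
        - specialize (Hg1 r Hr'). assert (0 <= t * L) by (apply Rmult_le_pos; tauto). nra.
        - now apply disk_continuous_scal.
        - apply disk_continuous_const. }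
      assert (E2 : mean r psi2 <= t * L * (INR p * (Cmod a * Cmod w * F))).
      { unfold psi2. rewrite mean_scal by (try assumption; now apply disk_continuous_Re).
        rewrite (mean_value h) by assumption.
        rewrite Rmult_assoc, Rmult_assoc. rewrite (Rmult_assoc t L). 
        repeat apply Rmult_le_compat_l; try tauto. apply pos_INR. }
      assert (E3 : mean r psi3 = - (INR p * t) * F).
      { unfold psi3. rewrite mean_scal by (try assumption; now apply disk_continuous_Re).
        rewrite (mean_value (fun z => e * f z)%C) by assumption. now rewrite Hef. }
      assert (E4 : mean r psi4 <= t ^ 2 * K).
      { unfold psi4. rewrite mean_scal, mean_plus by (try assumption; now apply disk_continuous_plus).
        replace (t ^ 2 * K) with (t ^ 2 * INR (n + 3) * 2 ^ p * (1 + B)) by (unfold K; ring).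
        apply Rmult_le_compat_l.
        - repeat apply Rmult_le_pos; [tauto|tauto|lra|apply pos_INR|apply pow_le; lra].
        - specialize (Hg1 r Hr'). specialize (HB r Hr'). lra. }
      lra. }
  apply Rnot_lt_le. intros Hlt.
  set (d := INR p * F * (1 - 4 * root_constant n * Cmod w)).
  assert (HpR : 0 < INR p) by now apply lt_0_INR.
  assert (Hd : 0 < d) by (unfold d; repeat apply Rmult_lt_0_compat; lra).
  assert (Hdle : forall t, 0 <= t <= 1 -> t * d <= t ^ 2 * K).
  { intros t Ht. specialize (Hgain t Ht).
    assert (HLa : L * Cmod a <= 4 * root_constant n).
    { unfold L. rewrite Rmult_assoc, (Rmult_comm 4). apply Rmult_le_compat_l; [|assumption].
      left; apply root_constant_pos. }
    assert (Hq : 0 <= t * (INR p * (Cmod w * F))).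
    { repeat apply Rmult_le_pos; try tauto; try lra. apply Cmod_ge_0. }
    apply (Rmult_le_compat_l _ _ _ Hq) in HLa. unfold d. lra. }
  (* dividing by t and letting t tend to 0 leaves d <= 0 *)
  assert (HK1 : d <= K) by (specialize (Hdle 1); lra).
  specialize (Hdle (d / (2 * K))).
  assert (Ht : 0 < d / (2 * K) <= 1).
  { split; [apply Rdiv_lt_0_compat; lra|]. apply Rle_div_l; lra. }
  specialize (Hdle ltac:(lra)).
  replace ((d / (2 * K)) ^ 2 * K) with (d / (2 * K) * (d / 2)) in Hdle by (field; lra).
  apply Rmult_le_reg_l in Hdle; lra.
Qed.

Theorem theorem5p16 :
  forall p : nat, (2 < p)%nat -> Nat.Even p ->
  exists rho : R, 0 < rho /\
    forall f : C -> C, in_Hp (INR p) f -> f (RtoC 0) <> RtoC 0 ->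
    forall a w : C,
      is_OPA 1 (INR p) f (fun z : C => Cmult a (Cminus z w)) ->
      rho <= Cmod w.
Proof.
  intros p Hp [k Hk].
  assert (Hn : p = (2 * ((k - 2) + 2))%nat) by lia. set (n := (k - 2)%nat) in Hn.
  pose proof (root_constant_pos n) as Hc.
  exists (Rmin (1 / 4) (/ (4 * root_constant n))). split.
  { apply Rmin_pos; [lra|]. apply Rinv_0_lt_compat. lra. }
  intros f Hf Hf0 a w HO. rewrite Hn in Hf, HO.
  destruct (Rle_dec (Cmod w) (1 / 4)) as [Hw|Hw].
  - eapply Rle_trans; [apply Rmin_r|].
    pose proof (OPA_root_bound n f a w Hf Hf0 HO Hw) as H.
    apply (Rmult_le_reg_l (4 * root_constant n)); [lra|]. rewrite Rinv_r by lra. exact H.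
  - eapply Rle_trans; [apply Rmin_l|]. lra.
Qed.
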